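(* For every ordinal $\alpha\le\omega$, the lattice of all locally compact (Hausdorff) shift-continuous topologies on the $\alpha$-bicyclic monoid $\mathcal{B}_{\alpha}$ coincides with the set $\{\tau_{i,\alpha}:1\le i\le\alpha\}$, linearly ordered by the inclusion relation, and hence is anti-isomorphic to the segment of ordinals $[1,\alpha]$ endowed with the natural well-order.
   Context: All topologies are assumed to be Hausdorff. A topology $\tau$ on a monoid $S$ is shift-continuous if for all $a,b\in S$ the map $S\to S$, $x\mapsto axb$, is continuous. The set of topologies is ordered by inclusion. Partially ordered sets $(X,\le_X)$ and $(Y,\le_Y)$ are anti-isomorphic if there is a bijection $f:X\to Y$ such that for all $x,y\in X$, $x\le_X y$ if and only if $f(y)\le_Y f(x)$. $[1,\alpha]$ is the set of ordinals $i$ with $1\le i\le\alpha$. Ordinals are von Neumann ordinals, $\omega^{\alpha}$ is ordinal exponentiation, and $+$ is ordinal addition. For ordinals $a\ge b$, $a-b$ denotes the unique ordinal $c$ with $a=b+c$. For $n\in\omega$ and an ordinal $t$, $n\omega^{t}$ denotes the sum of $n$ copies of $\omega^t$ (i.e. $\omega^t\cdot n$ in the standard notation for ordinal multiplication). $\mathbb{N}$ is the set of positive integers. For an ordinal $\alpha$, the $\alpha$-bicyclic monoid $\mathcal{B}_{\alpha}$ is the set $\omega^{\alpha}\times\omega^{\alpha}$ of pairs of ordinals less than $\omega^\alpha$, with the operation $(a,b)\cdot(c,d)=(a+(c-b),d)$ if $b\le c$, and $(a,b)\cdot(c,d)=(a,d+(b-c))$ if $b>c$. For ordinals $\alpha\le\omega$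 and $0<i\le\alpha$, $\tau_{i,\alpha}$ denotes the locally compact Hausdorff shift-continuous topology on $\mathcal{B}_{\alpha}$ uniquely determined by the following two conditions: (i) for every integer $j$ with $i\le j<\alpha$ the point $(\omega^{j},\omega^{j})$ is isolated in $\tau_{i,\alpha}$; (ii) for every positive integer $j$ with $j<i$, a neighborhood base of $\tau_{i,\alpha}$ at $(\omega^{j},\omega^{j})$ consists of the sets $U_n=\{(a,b): a<\omega^j,\ b<\omega^j,\ \text{and } (n\omega^{j-1}<a \text{ or } n\omega^{j-1}<b)\}\cup\{(\omega^j,\omega^j)\}$, $n\in\mathbb{N}$.
   Formalization: The case α = 0 is excluded: there the monoid is a single point carrying exactly one topology, while the set of τ_{i,0} with 1 ≤ i ≤ 0 and the segment [1,0] are empty, so the claim fails; the theorem is stated for 1 ≤ α ≤ ω. *)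

(* Defs.v *)
From HB Require Import structures.
From mathcomp Require Import all_boot all_order all_algebra zify.
From mathcomp Require Import all_classical.
From mathcomp Require Import topology.

Set Implicit Arguments.
Unset Strict Implicit.
Unset Printing Implicit Defensive.

Import Order.TTheory GRing.Theory.

Local Open Scope classical_set_scope.

(** An ordinal below omega^omega is encoded by its Cantor normal form
    [... + omega^2 * a_2 + omega * a_1 + a_0], i.e., by the finitely supported
    sequence of its coefficients; {poly nat} is the type of those sequences.
    Beware that the ring operations of {poly nat} are the natural (Hessenberg)
    ones, not the ordinal ones: only the coefficients are used below.

    This encoding is pinned down by the lemmas [ord_lt_wf] (the order is a
    well-order), [ord_le0], [ord_ltS] and
    [ord_lt_omega] (values of 0, n and omega),
    [ord_le_addr], [ord_lt_add2l], [ord_subKC] (b |-> a + b is the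
    isomorphism from the ordinals onto those above a), [ord_powS] (omega^(j+1)
    is the supremum of the n omega^j) and [lt_omega_powE]. *)

Definition ord : Type := {poly nat}.

HB.instance Definition _ := Choice.on ord.

Definition coef (a : ord) (k : nat) : nat := ((a : {poly nat})`_k)%R.

Definition ord_size (a : ord) : nat := size (a : {poly nat}).

Definition ord_lt (a b : ord) : bool :=
  `[< exists k, (coef a k < coef b k)%N
        /\ forall l, (k < l)%N -> coef a l = coef b l >].

Definition ord_le (a b : ord) : bool := (a == b) || ord_lt a b.

Lemma coefP (a b : ord) : (forall k, coef a k = coef b k) -> a = b.
Proof. by move=> ab; apply/polyP. Qed.

Lemma coef_ge_size (a : ord) k : (ord_size a <= k)%N -> coef a k = 0.
Proof. by move=> h; rewrite /coef nth_default. Qed.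

Lemma coef_lead (a : ord) k : ord_size a = k.+1 -> (0 < coef a k)%N.
Proof.
move=> h; rewrite lt0n; have: lead_coef (a : {poly nat}) != 0%R.
  by rewrite lead_coef_eq0 -size_poly_eq0 -/(ord_size a) h.
by rewrite /lead_coef -/(ord_size a) h.
Qed.

Lemma coef_gt0_size (a : ord) k : (0 < coef a k)%N -> (k < ord_size a)%N.
Proof. by move=> h; rewrite ltnNge; apply: contraTN h => /coef_ge_size ->. Qed.

Lemma ord_size_le (a : ord) n :
  (forall k, (n <= k)%N -> coef a k = 0) -> (ord_size a <= n)%N.
Proof. by move=> h; apply/leq_sizeP. Qed.

Fact ord_lt_irr : irreflexive ord_lt.
Proof. by move=> a; apply/negbTE/asboolPn => -[k []]; rewrite ltnn. Qed.

Fact ord_lt_trans : transitive ord_lt.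
Proof.
move=> b a c /asboolP[k [ab abl]] /asboolP[m [bc bcl]]; apply/asboolP.
case: (ltngtP k m) => km.
- by exists m; split=> [|l ml]; [rewrite abl|rewrite abl ?bcl//; lia].
- by exists k; split=> [|l kl]; [rewrite -bcl|rewrite abl ?bcl//; lia].
- exists k; split=> [|l kl]; first by rewrite -km in bc; lia.
  by rewrite abl ?bcl -?km.
Qed.

Fact ord_lt_total (a b : ord) : a != b -> ord_lt a b || ord_lt b a.
Proof.
move=> ab; pose P k := coef a k != coef b k.
have exP : exists k, P k.
  apply: contrapT => nP; move/eqP: ab; apply; apply: coefP => k.
  by apply/eqP/negPn/negP => Pk; apply: nP; exists k.
have bdP k : P k -> (k <= maxn (ord_size a) (ord_size b))%N.
  apply: contraTT; rewrite -ltnNge => h; rewrite /P negbK.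
  by rewrite !coef_ge_size//; lia.
case: (ex_maxnP exP bdP) => k Pk maxk.
have eqk l : (k < l)%N -> coef a l = coef b l.
  by move=> kl; apply/eqP/negPn/negP => /maxk; lia.
case: (ltngtP (coef a k) (coef b k)) => h.
- by apply/orP; left; apply/asboolP; exists k.
- by apply/orP; right; apply/asboolP; exists k; split=> // l /eqk.
- by move: Pk; rewrite /P h eqxx.
Qed.

HB.instance Definition _ := Order.LtOrder.Build (Order.Disp tt tt) ord
  (fun _ _ => erefl) (fun _ _ => erefl) (fun _ _ => erefl)
  ord_lt_irr ord_lt_trans ord_lt_total.

Lemma ord_ltP (a b : ord) :
  reflect (exists k, (coef a k < coef b k)%N
             /\ forall l, (k < l)%N -> coef a l = coef b l) (a < b)%O.
Proof. exact: asboolP. Qed.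

Lemma ord_lt_wf : well_founded (fun a b : ord => (a < b)%O).
Proof.
have size_lt (a b : ord) n : (a < b)%O -> (ord_size b <= n -> ord_size a <= n)%N.
  move=> /ord_ltP[k [ab abl]] bn; apply: ord_size_le => l nl.
  have kb := @coef_gt0_size b k ltac:(lia).
  by rewrite abl ?coef_ge_size//; lia.
suff acc n (a : ord) : (ord_size a <= n)%N -> Acc (fun a b : ord => (a < b)%O) a.
  by move=> a; apply: (acc (ord_size a)).
elim: n a => [a a0|n IHn a].
  constructor=> b /ord_ltP[k [ab _]].
  by have := @coef_gt0_size a k ltac:(lia); lia.
move em: (coef a n) => m; elim/ltn_ind: m a em => m IHm.
pose low (a : ord) : ord := (\poly_(i < n) coef a i)%R.
have lowE a k : coef (low a) k = if (k < n)%N then coef a k else 0.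
  by rewrite /coef coef_poly.
suff acc r : Acc (fun a b : ord => (a < b)%O) r -> forall a, low a = r ->
    coef a n = m -> (ord_size a <= n.+1)%N -> Acc (fun a b : ord => (a < b)%O) a.
  move=> a am an; apply: (acc (low a) _ a erefl am an); apply: IHn.
  by apply: ord_size_le => k nk; rewrite lowE ltnNge nk.
elim=> {}r _ IHr a ar am an; constructor=> b ba.
have bn := size_lt _ _ _ ba an.
case: (ltngtP (coef b n) m) => bm.
- exact: IHm bm b erefl bn.
- move/ord_ltP: ba => [k [bak bal]].
  have ka := @coef_gt0_size a k ltac:(lia).
  case: (ltngtP k n) => kn; first by have := bal _ kn; lia.
    by lia.
  by move: bak; rewrite kn; lia.
- apply: (IHr (low b)) => //; move/ord_ltP: ba => [k [bak bal]].
  have ka := @coef_gt0_size a k ltac:(lia).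
  have kn : (k < n)%N.
    by rewrite ltn_neqAle; apply/andP; split; last lia; apply: contraTN bak => /eqP ->; lia.
  rewrite -ar; apply/ord_ltP; exists k; split; first by rewrite !lowE kn.
  by move=> l kl; rewrite !lowE; case: ifP => // ln; apply: bal.
Qed.

Definition ord_of_nat (n : nat) : ord := (n%:P)%R.

Definition omega : ord := 'X%R.

Definition omega_pow (j : nat) : ord := ('X^j)%R.

(* Adding b of degree d erases the coefficients of a of index less than d, and
   adds up those of index d; [ord_size b] is d + 1, or 0 if b = 0. *)
Definition ord_add (a b : ord) : ord :=
  (\poly_(k < maxn (ord_size a) (ord_size b))
     if (k.+1 < ord_size b)%N then coef b k
     else if k.+1 == ord_size b then (coef a k + coef b k)%N
     else coef a k)%R.

Notation "n %:O" := (ord_of_nat n) (at level 2, left associativity, format "n %:O").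
Notation "a +o b" := (ord_add a b) (at level 50, left associativity).

(* n omega^t *)
Definition omega_pow_mul (n t : nat) : ord :=
  iter n (fun a => a +o omega_pow t) 0%:O.

(* The unique c such that a = b + c, if b <= a *)
Definition ord_sub (a b : ord) : ord := xget 0%:O [set c | a = b +o c].

Notation "a -o b" := (ord_sub a b) (at level 50, left associativity).

(* a < omega^alpha for any alpha <= omega, as omega^omega itself is not in ord:
   a = 0 or the degree of a is less than alpha *)
Definition lt_omega_pow (alpha a : ord) : bool :=
  (a == 0%:O) || ((ord_size a).-1%:O < alpha)%O.

Lemma coef_nat n k : coef n%:O k = if k == 0 then n else 0.
Proof. by rewrite /coef coefC. Qed.

Lemma coef_omega_pow j k : coef (omega_pow j) k = (k == j).
Proof. by rewrite /coef coefXn; case: (k == j). Qed.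

Lemma coef_omega k : coef omega k = (k == 1).
Proof. by rewrite -[omega]/(omega_pow 1) coef_omega_pow. Qed.

Lemma ord_size_omega_pow j : ord_size (omega_pow j) = j.+1.
Proof. by rewrite /ord_size size_polyXn. Qed.

Lemma ord_size0 : ord_size 0%:O = 0.
Proof. by rewrite /ord_size size_polyC. Qed.

Lemma coef0 k : coef 0%:O k = 0.
Proof. by rewrite coef_nat; case: ifP. Qed.

Lemma ord_size_eq0 (a : ord) : (ord_size a == 0) = (a == 0%:O).
Proof. by rewrite /ord_size size_poly_eq0 /ord_of_nat polyC0. Qed.

Lemma coef_add a b k : coef (a +o b) k =
  if (k.+1 < ord_size b)%N then coef b k
  else if k.+1 == ord_size b then (coef a k + coef b k)%N
  else coef a k.
Proof.
rewrite {1}/coef coef_poly; case: ifP => // kab.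
have ka : (ord_size a <= k)%N by lia.
have kb : (ord_size b <= k)%N by lia.
by rewrite !coef_ge_size//; do !case: ifP.
Qed.

Lemma ord_size_add a b : ord_size (a +o b) = maxn (ord_size a) (ord_size b).
Proof.
apply/eqP; rewrite eqn_leq; apply/andP; split.
  apply: ord_size_le => k kab; have ka : (ord_size a <= k)%N by lia.
  have kb : (ord_size b <= k)%N by lia.
  by rewrite coef_add !coef_ge_size//; do !case: ifP.
case em: (maxn _ _) => [//|m]; apply: coef_gt0_size; rewrite coef_add.
case: ifP => [|_]; first by lia.
case: eqP => [mb|mb]; first by have := @coef_lead b m ltac:(lia); lia.
by apply: coef_lead; lia.
Qed.

Lemma ord_le0 a : (0%:O <= a)%O.
Proof. by rewrite leNgt; apply/negP => /ord_ltP[k []]; rewrite coef0. Qed.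

Lemma ord_ltS a n : (a < n.+1%:O)%O = (a <= n%:O)%O.
Proof.
apply/idP/idP => [/ord_ltP[k []]|]; last first.
  move=> /le_lt_trans; apply; apply/ord_ltP; exists 0.
  by split=> [|[|l]]; rewrite !coef_nat.
rewrite coef_nat; case: eqP => [->{k} an al|//].
have {}al l : (0 < l)%N -> coef a l = 0.
  by case: l => // l /al ->; rewrite coef_nat.
case: (ltngtP (coef a 0) n) => a0n; last 2 first.
- by lia.
- rewrite le_eqVlt; apply/orP; left; apply/eqP/coefP => -[|l].
    by rewrite coef_nat.
  by rewrite al// coef_nat.
apply/ltW/ord_ltP; exists 0; split=> [|[//|l] _]; first by rewrite coef_nat.
by rewrite al// coef_nat.
Qed.

Lemma ord_lt1 a : (a < 1%:O)%O = (a == 0%:O).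
Proof. by rewrite ord_ltS eq_le ord_le0 andbT. Qed.

Lemma ord_lt_omega a : (a < omega)%O <-> exists n, a = n%:O.
Proof.
split=> [/ord_ltP[k []]|[n ->]]; last first.
  apply/ord_ltP; exists 1; rewrite coef_omega coef_nat; split=> // -[|[|l]]//.
  by rewrite coef_omega coef_nat.
rewrite coef_omega; case: eqP => [->{k} a1 al|//].
exists (coef a 0); apply: coefP => -[|[|l]]; rewrite coef_nat//=.
  by move: a1; case: (coef a 1).
by rewrite al// coef_omega.
Qed.

Lemma ord_lt_add2l a b c : (a +o b < a +o c)%O = (b < c)%O.
Proof.
have mono b' c' : (b' < c')%O -> (a +o b' < a +o c')%O.
  move=> /ord_ltP[k [bc bcl]]; apply/ord_ltP; exists k.
  have kc := @coef_gt0_size c' k ltac:(lia).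
  have bsc : (ord_size b' <= ord_size c')%N.
    by apply: ord_size_le => l cl; rewrite bcl ?coef_ge_size//; lia.
  case: (ltngtP k.+1 (ord_size c')) => kc'; last 2 first.
  - by lia.
  - split.
      rewrite !coef_add -kc' ltnn eqxx.
      case: ifP => [|_]; first by lia.
      by case: eqP => bk; lia.
    move=> l kl; rewrite !coef_add -kc'.
    by do 2 (case: ifP; first by lia); move=> _ _; do 2 (case: ifP; first by lia).
  have bsc' : ord_size b' = ord_size c'.
    apply/eqP; rewrite eqn_leq bsc/=; case ec: (ord_size c') => [//|m].
    apply: coef_gt0_size; rewrite bcl; last by lia.
    exact: coef_lead.
  split; first by rewrite !coef_add bsc' kc'.
  by move=> l kl; rewrite !coef_add bsc' bcl.
case: (ltgtP b c) => [/mono->//|/mono|->]; last by rewrite ltxx.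
by move=> h; apply/negbTE; rewrite -leNgt ltW.
Qed.

Lemma ord_addr0 a : a +o 0%:O = a.
Proof. by apply: coefP => k; rewrite coef_add ord_size0. Qed.

Lemma ord_add0r a : 0%:O +o a = a.
Proof.
apply: coefP => k; rewrite coef_add coef0 add0n.
case: ifP => // h1; case: ifP => // h2; rewrite coef_ge_size//; lia.
Qed.

Lemma ord_le_addr a b : (a <= a +o b)%O.
Proof.
by rewrite -{1}[a]ord_addr0 leNgt ord_lt_add2l -leNgt ord_le0.
Qed.

Lemma ord_addI a : injective (ord_add a).
Proof.
move=> b c e; apply/eqP; rewrite eq_le !leNgt.
by rewrite -(ord_lt_add2l a c b) -(ord_lt_add2l a b c) e ltxx.
Qed.

Lemma ord_addA a b c : a +o (b +o c) = a +o b +o c.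
Proof.
apply: coefP => k; rewrite !coef_add ord_size_add.
move: (ord_size a) (ord_size b) (ord_size c) (@coef_ge_size b k).
move=> sa sb sc b0; repeat case: ifP => ?; lia.
Qed.

Lemma ord_sub_exists a b : (b <= a)%O -> exists c, a = b +o c.
Proof.
rewrite le_eqVlt => /predU1P[->|/ord_ltP[k [ba bal]]].
  by exists 0%:O; rewrite ord_addr0.
pose c : ord := (\poly_(i < k.+1) if i == k then (coef a k - coef b k)%N
                                 else coef a i)%R.
have cE i : coef c i = if (i < k.+1)%N then
    if i == k then (coef a k - coef b k)%N else coef a i else 0.
  by rewrite /coef coef_poly.
have sc : ord_size c = k.+1.
  apply/eqP; rewrite eqn_leq size_poly/=; apply: coef_gt0_size.
  by rewrite cE ltnSn eqxx; lia.
exists c; apply: coefP => i; rewrite coef_add cE sc.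
case: (ltngtP i k) => ik.
- by rewrite ltnS ik ltnS ltnW.
- by rewrite ltnS ltnNge ltnW//= eqSS gtn_eqF// bal.
- by rewrite ik ltnn eqxx ltnSn; lia.
Qed.

Lemma ord_subKC a b : (b <= a)%O -> b +o (a -o b) = a.
Proof.
move=> /ord_sub_exists[c h]; rewrite /ord_sub.
by case: xgetP => [_ _ <-//|/(_ c)].
Qed.

Lemma ord_addKC a b : a +o b -o a = b.
Proof. by apply: (@ord_addI a); rewrite ord_subKC// ord_le_addr. Qed.

Lemma ord_pow0 : omega_pow 0 = 1%:O.
Proof. by apply: coefP => k; rewrite [RHS]coef_nat [LHS]coef_omega_pow; case: k. Qed.

Lemma ord_pow1 : omega_pow 1 = omega.
Proof. by []. Qed.

Lemma coef_omega_pow_mul n t k :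
  coef (omega_pow_mul n t) k = if k == t then n else 0.
Proof.
elim: n k => [|n IH] k; first by rewrite coef0; case: ifP.
rewrite /omega_pow_mul/= -/(omega_pow_mul n t) coef_add ord_size_omega_pow.
rewrite !IH !coef_omega_pow eqSS; case: (ltngtP k t) => kt.
- by rewrite ltnS kt.
- by rewrite ltnS ltnNge ltnW.
- by rewrite kt ltnn addn1.
Qed.

Lemma omega_pow_mul0 n : omega_pow_mul n 0 = n%:O.
Proof. by apply: coefP => k; rewrite coef_omega_pow_mul coef_nat. Qed.

Lemma lt_omega_powE (j : nat) a : lt_omega_pow j%:O a = (a < omega_pow j)%O.
Proof.
have ltnat m n : (m%:O < n%:O)%O = (m < n)%N.
  apply/ord_ltP/idP => [[k []]|mn].
    by rewrite !coef_nat; case: eqP.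
  by exists 0; split=> [|[//|l] _]; rewrite !coef_nat.
rewrite /lt_omega_pow ltnat -ord_size_eq0.
have -> : (ord_size a == 0) || ((ord_size a).-1 < j)%N =
          ((ord_size a == 0) || (ord_size a <= j)%N) by lia.
have -> : (ord_size a == 0) || (ord_size a <= j)%N = (ord_size a <= j)%N by lia.
apply/idP/ord_ltP => [aj|[k []]].
  exists j; rewrite coef_omega_pow eqxx coef_ge_size//; split=> // l jl.
  by rewrite coef_omega_pow gtn_eqF// coef_ge_size//; lia.
rewrite coef_omega_pow; case: eqP => [->{k} aj al|//].
apply: ord_size_le => k; rewrite leq_eqVlt => /predU1P[<-|jk]; first by lia.
by rewrite al// coef_omega_pow gtn_eqF.
Qed.

Lemma lt_omega_pow_omega a : lt_omega_pow omega a.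
Proof. by apply/orP; right; apply/ord_lt_omega; exists (ord_size a).-1. Qed.

Lemma ord_powS j a :
  (a < omega_pow j.+1)%O <-> exists n, (a < omega_pow_mul n j)%O.
Proof.
rewrite -lt_omega_powE; split=> [|[n an]].
  rewrite lt_omega_powE => /ord_ltP[k []]; rewrite coef_omega_pow.
  case: eqP => [->{k} aj al|//]; exists (coef a j).+1; apply/ord_ltP; exists j.
  rewrite coef_omega_pow_mul eqxx; split=> // l; rewrite leq_eqVlt.
  rewrite coef_omega_pow_mul => /predU1P[<-|jl].
    by rewrite gtn_eqF//; lia.
  by rewrite al// coef_omega_pow !gtn_eqF//; lia.
rewrite lt_omega_powE; apply: lt_trans an _; apply/ord_ltP; exists j.+1.
rewrite coef_omega_pow_mul coef_omega_pow eqxx gtn_eqF//; split=> // l jl.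
by rewrite coef_omega_pow_mul coef_omega_pow !gtn_eqF//; lia.
Qed.

Definition pair_mul (p q : ord * ord) : ord * ord :=
  if (p.2 <= q.1)%O then (p.1 +o (q.1 -o p.2), q.2)
  else (p.1, q.2 +o (p.2 -o q.1)).

Definition bicyclic (alpha : ord) : Type :=
  {p : ord * ord | lt_omega_pow alpha p.1 && lt_omega_pow alpha p.2}.

Lemma pair_mulA : associative pair_mul.
Proof.
have lL a b u d : pair_mul (a, b) (b +o u, d) = (a +o u, d).
  by rewrite /pair_mul/= ord_le_addr ord_addKC.
have lR a c u d : pair_mul (a, c +o u) (c, d) = (a, d +o u).
  rewrite /pair_mul/=; case: ifP => [h|_]; last by rewrite ord_addKC.
  have e : c +o u = c by apply/eqP; rewrite eq_le h ord_le_addr.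
  have {}e : u = 0%:O by apply: (@ord_addI c); rewrite e ord_addr0.
  by rewrite e !ord_addr0 -{1}(ord_addr0 c) ord_addKC ord_addr0.
move=> [a b] [c d] [e f].
have cmp x y : (exists u, y = x +o u) \/ (exists u, x = y +o u).
  by case: (leP x y) => [|/ltW] /ord_sub_exists; [left|right].
case: (cmp b c) => -[u ->]; rewrite ?lL ?lR.
  case: (cmp d e) => -[v ->]; rewrite ?lL ?lR.
    by rewrite -!ord_addA lL ord_addA.
  by rewrite lL.
case: (cmp d e) => -[v ->]; rewrite ?lL ?lR.
  case: (cmp u v) => -[w ->]; rewrite ?ord_addA.
    by rewrite !lL.
  by rewrite !lR.
by rewrite -!ord_addA lR !ord_addA.
Qed.

Lemma lt_omega_pow_size alpha (a b : ord) : (ord_size a <= ord_size b)%N ->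
  lt_omega_pow alpha b -> lt_omega_pow alpha a.
Proof.
rewrite /lt_omega_pow -!ord_size_eq0 => ab.
case: (ord_size a =P 0) => //= a0; case: eqP => [|_ /=]; first by lia.
apply: le_lt_trans; rewrite le_eqVlt.
case: ltngtP (ab) => // [h _|-> _]; last by rewrite eqxx.
apply/orP; right; apply/ord_ltP; exists 0; split; first by rewrite !coef_nat/=; lia.
by case=> // ? _; rewrite !coef_nat.
Qed.

Lemma lt_omega_pow_add alpha (a b : ord) :
  lt_omega_pow alpha a -> lt_omega_pow alpha b -> lt_omega_pow alpha (a +o b).
Proof.
move=> ha hb; case: (leqP (ord_size a) (ord_size b)) => ab.
  by apply: lt_omega_pow_size hb; rewrite ord_size_add; lia.
by apply: lt_omega_pow_size ha; rewrite ord_size_add; lia.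
Qed.

Lemma lt_omega_pow_sub alpha (a b : ord) : (b <= a)%O ->
  lt_omega_pow alpha a -> lt_omega_pow alpha (a -o b).
Proof.
move=> /ord_subKC h; apply: lt_omega_pow_size.
by rewrite -{2}h ord_size_add; lia.
Qed.

Fact bicyclic_mul_subproof alpha (x y : bicyclic alpha) :
  let p := pair_mul (val x) (val y) in
  lt_omega_pow alpha p.1 && lt_omega_pow alpha p.2.
Proof.
move: x y => [[a b] /= /andP[ha hb]] [[c d] /= /andP[hc hd]].
rewrite /pair_mul/=; case: leP => h /=; apply/andP; split=> //;
  by apply: lt_omega_pow_add => //; apply: lt_omega_pow_sub => //; exact: ltW.
Qed.

Definition bicyclic_mul alpha (x y : bicyclic alpha) : bicyclic alpha :=
  Sub (pair_mul (val x) (val y)) (bicyclic_mul_subproof x y).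

Fact bicyclic_one_subproof alpha :
  lt_omega_pow alpha (0%:O, 0%:O).1 && lt_omega_pow alpha (0%:O, 0%:O).2.
Proof. by rewrite /lt_omega_pow eqxx. Qed.

Definition bicyclic_one alpha : bicyclic alpha :=
  Sub (0%:O, 0%:O) (bicyclic_one_subproof alpha).

Fact bicyclic_mulA alpha : associative (@bicyclic_mul alpha).
Proof. by move=> x y z; apply: val_inj; rewrite /= pair_mulA. Qed.

Fact bicyclic_mul1 alpha : left_id (bicyclic_one alpha) (@bicyclic_mul alpha).
Proof.
move=> [[a b] h]; apply: val_inj; rewrite /= /pair_mul/= ord_le0.
by rewrite -{1}[a]ord_add0r ord_addKC ord_add0r.
Qed.

Fact bicyclic_1mul alpha : right_id (bicyclic_one alpha) (@bicyclic_mul alpha).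
Proof.
move=> [[a b] h]; apply: val_inj; rewrite /= /pair_mul/=.
case: ifP => [b0|_].
  have -> : b = 0%:O by apply/eqP; rewrite eq_le b0 ord_le0.
  by rewrite -{1}[0%:O]ord_addr0 ord_addKC ord_addr0.
by rewrite -{1}[b]ord_add0r ord_addKC ord_add0r.
Qed.

HB.instance Definition _ alpha := Choice.on (bicyclic alpha).
HB.instance Definition _ alpha := isMonoid.Build (bicyclic alpha)
  (@bicyclic_mulA alpha) (@bicyclic_mul1 alpha) (@bicyclic_1mul alpha).

Record topology (T : Type) := Topology {
  opens : set (set T) ;
  opensT : opens [set: T] ;
  opensI : setI_closed opens ;
  opens_bigcup : forall F : set (set T), F `<=` opens ->
    opens (\bigcup_(A in F) A)
}.

HB.instance Definition _ (T : Type) := gen_eqMixin (topology T).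
HB.instance Definition _ (T : Type) := gen_choiceMixin (topology T).

Lemma topology_inj (T : Type) : injective (@opens T).
Proof.
move=> [O1 T1 I1 U1] [O2 T2 I2 U2] /= e; move: T1 I1 U1 T2 I2 U2; rewrite e.
by move=> *; f_equal; exact: Prop_irrelevance.
Qed.

Definition topologized (T : choiceType) (tau : topology T) : Type := T.

HB.instance Definition _ (T : choiceType) (tau : topology T) :=
  Choice.on (topologized tau).

Fact topologized_bigU (T : choiceType) (tau : topology T) (I : Type)
  (f : I -> set (topologized tau)) :
  (forall i, opens tau (f i)) -> opens tau (\bigcup_i f i).
Proof.
move=> fo; have := @opens_bigcup _ tau (range f); rewrite bigcup_image.
by apply=> _ [i _ <-].
Qed.

HB.instance Definition _ (T : choiceType) (tau : topology T) :=
  isOpenTopological.Build (topologized tau)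
    (opensT tau) (@opensI _ tau) (@topologized_bigU T tau).

Lemma open_topologized (T : choiceType) (tau : topology T)
  (U : set (topologized tau)) : open U = opens tau U.
Proof. by []. Qed.

Definition coarser (T : Type) (tau sigma : topology T) : Prop :=
  opens tau `<=` opens sigma.

Fact full_topology_bigcup (T : Type) (F : set (set T)) :
  F `<=` [set: set T] -> [set: set T] (\bigcup_(A in F) A).
Proof. by []. Qed.

Definition full_topology (T : Type) : topology T :=
  @Topology T [set: set T] I (fun _ _ _ _ => I) (@full_topology_bigcup T).

Definition shift_continuous (S : monoidType) (tau : topology S) : Prop :=
  forall a b : S,
    continuous ((fun x => (a * x * b)%g) : topologized tau -> topologized tau).

Definition lc_shift_topologies (S : monoidType) : set (topology S) :=
  [set tau | [/\ hausdorff_space (topologized tau),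
                 locally_compact [set: topologized tau]
               & shift_continuous tau]].

Arguments lc_shift_topologies : clear implicits.

Definition tau_nbhd (alpha : ord) (j n : nat) : set (bicyclic alpha) :=
  [set x | let: (a, b) := val x in
     [/\ (a < omega_pow j)%O, (b < omega_pow j)%O
       & (omega_pow_mul n j.-1 < a)%O \/ (omega_pow_mul n j.-1 < b)%O]
     \/ (a, b) = (omega_pow j, omega_pow j)].

Arguments tau_nbhd : clear implicits.

(* In the last two conditions x is the point (omega^j, omega^j). The sets
   tau_nbhd alpha j n are neighbourhoods of that point, but not open ones if j > 1. *)
Definition is_tau (alpha i : ord) : set (topology (bicyclic alpha)) :=
  [set tau |
    [/\ lc_shift_topologies (bicyclic alpha) tau,
        forall (j : nat) (x : bicyclic alpha),
          (i <= j%:O)%O -> (j%:O < alpha)%O ->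
          val x = (omega_pow j, omega_pow j) ->
          opens tau [set x]
      & forall (j : nat) (x : bicyclic alpha),
          (0 < j)%N -> (j%:O < i)%O ->
          val x = (omega_pow j, omega_pow j) ->
          nbhs (x : topologized tau) =
            filter_from [set n | (0 < n)%N] (tau_nbhd alpha j)]].

Arguments is_tau : clear implicits.

(* Definite description; the full topology is a dummy value. *)
Definition tau (alpha i : ord) : topology (bicyclic alpha) :=
  xget (full_topology (bicyclic alpha)) (is_tau alpha i).

Definition ord_segment (alpha : ord) : set ord :=
  [set i | (1%:O <= i <= alpha)%O].

Definition anti_isomorphic (X Y : Type) (A : set X) (leX : X -> X -> Prop)
    (B : set Y) (leY : Y -> Y -> Prop) : Prop :=
  exists2 f : X -> Y, set_bij A B f
    & forall x y, A x -> A y -> leX x y <-> leY (f y) (f x).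

(* Main.v *)
(** Write [z_j] for the point [(omega^j, omega^j)] and [y + t] for the pair
    obtained from [y] by adding [t] to both coordinates. The natural partial
    order of the inverse monoid B_alpha is: [x <= y] iff [x = y + t] for some
    [t]; it is a tree order, i.e., the up-sets of two points are disjoint or
    nested.

    In a Hausdorff shift-continuous topology all up-sets are clopen: the identity
    is isolated, and the up-set of [(a,b)] is its inverse image under
    [x |-> (0,a) x (b,0)]. It follows that translations are local homeomorphisms
    at the non-isolated points and that the neighbourhoods of the points [z_j]
    determine the topology. If moreover the topology is locally compact and
    [z_j] is not isolated, then a compact neighbourhood of [z_j] is invariant,
    near [z_j], under multiplication by any element fixing [z_j]; cutting the
    pairs below [omega^j] into blocks indexed by a quarter-plane, which has one
    end, one sees that this neighbourhood contains some [U_n]. Hence [U_n] lies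
    in a compact set, which prevents the points [z_k], [k < j], from being
    isolated.

    Conversely [tau_i] is the topology in which the sets
    [{y | exists t < omega^i, x = y + t}] are declared clopen; they are compact
    because of the tree property and of the well-foundedness of ordinals. *)

Require Import Defs.
From mathcomp Require Import all_boot all_order all_algebra zify.
From mathcomp Require Import all_classical.
From mathcomp Require Import topology.

Set Implicit Arguments.
Unset Strict Implicit.
Unset Printing Implicit Defensive.

Import Order.TTheory.

Local Open Scope classical_set_scope.

(** * Ordinal arithmetic *)

Lemma ord_nat_lt m n : (m%:O < n%:O)%O = (m < n)%N.
Proof.
apply/ord_ltP/idP => [[k []]|mn]; first by rewrite !coef_nat; case: eqP.
by exists 0; split=> [|[//|l] _]; rewrite !coef_nat.
Qed.

Lemma ord_nat_le m n : (m%:O <= n%:O)%O = (m <= n)%N.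
Proof. by rewrite leNgt ord_nat_lt -leqNgt. Qed.

Lemma ord_add_eq_self a t : a +o t = a -> t = 0%:O.
Proof. by move=> e; apply: (@ord_addI a); rewrite e ord_addr0. Qed.

Lemma ord_add_eq0r a t : a +o t = 0%:O -> t = 0%:O.
Proof.
move=> e; apply/eqP; rewrite -ord_size_eq0.
by move: (ord_size_add a t); rewrite e ord_size0; lia.
Qed.

Lemma ord_cmp a b : (exists u, b = a +o u) \/ (exists u, a = b +o u).
Proof.
by case: (leP a b) => [|/ltW] /ord_sub_exists; [left|right].
Qed.

Lemma lt_omega_powP (j : nat) a : (a < omega_pow j)%O = (ord_size a <= j)%N.
Proof.
rewrite -lt_omega_powE /lt_omega_pow -ord_size_eq0 ord_nat_lt.
by case: (ord_size a) => [|n] /=; rewrite ?leq0n.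
Qed.

Lemma lt_omega_pow0 i : lt_omega_pow i 0%:O.
Proof. by rewrite /lt_omega_pow eqxx. Qed.

Lemma lt_omega_pow_addr i a b : lt_omega_pow i (a +o b) -> lt_omega_pow i b.
Proof. by apply: lt_omega_pow_size; rewrite ord_size_add; lia. Qed.

Lemma lt_omega_pow_addl i a b : lt_omega_pow i (a +o b) -> lt_omega_pow i a.
Proof. by apply: lt_omega_pow_size; rewrite ord_size_add; lia. Qed.

Lemma lt_omega_pow_pow i j : lt_omega_pow i (omega_pow j) = (j%:O < i)%O.
Proof.
by rewrite /lt_omega_pow -ord_size_eq0 ord_size_omega_pow.
Qed.

Lemma lt_omega_pow_small i j a : (j%:O < i)%O -> (ord_size a <= j.+1)%N ->
  lt_omega_pow i a.
Proof.
move=> ji aj; apply: (@lt_omega_pow_size _ _ (omega_pow j)).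
  by rewrite ord_size_omega_pow.
by rewrite lt_omega_pow_pow.
Qed.

Lemma ord_add_absorb a j : (ord_size a <= j)%N ->
  a +o omega_pow j = omega_pow j.
Proof.
move=> aj; apply: coefP => k; rewrite coef_add ord_size_omega_pow.
case: ifP => // kj; case: eqP => [|kj']; first by rewrite coef_ge_size//; lia.
by rewrite !coef_ge_size// ?ord_size_omega_pow; lia.
Qed.

(** A power of omega absorbs every smaller left summand, so its only remainders are 0 and itself. *)
Lemma ord_add_eq_pow p t j : p +o t = omega_pow j ->
  (p = omega_pow j /\ t = 0%:O) \/ ((ord_size p <= j)%N /\ t = omega_pow j).
Proof.
move=> e; have := ord_le_addr p t; rewrite e le_eqVlt => /predU1P[pj|].
  by left; split=> //; move: e; rewrite pj => /ord_add_eq_self.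
rewrite lt_omega_powP => pj; right; split=> //.
by apply: (@ord_addI p); rewrite ord_add_absorb.
Qed.

Lemma coef_pow_addl k p : (ord_size p <= k.+1)%N ->
  coef (omega_pow k +o p) k = (coef p k).+1.
Proof.
move=> pk; rewrite coef_add coef_omega_pow eqxx /=.
case: ifP => [|_]; first lia.
case: eqP => [_|/eqP]; first by lia.
by move=> kp; rewrite coef_ge_size//; lia.
Qed.

Lemma ord_size_pow_addl k p : (ord_size p <= k.+1)%N ->
  ord_size (omega_pow k +o p) = k.+1.
Proof. by rewrite ord_size_add ord_size_omega_pow; lia. Qed.

Lemma coef_pow_subl k p : (ord_size p <= k.+1)%N -> (0 < coef p k)%N ->
  exists2 q, p = omega_pow k +o q & (ord_size q <= k.+1)%N.
Proof.
move=> pk p0; case: (leP (omega_pow k) p) => [/ord_sub_exists[q e]|].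
  by exists q => //; move: (ord_size_add (omega_pow k) q); rewrite -e; lia.
by rewrite lt_omega_powP => /coef_ge_size; lia.
Qed.

(** * Adding and removing blocks of length omega^k *)

Definition pow_iter k n q := iter n (ord_add (omega_pow k)) q.

Lemma coef_pow_iter k n q : (ord_size q <= k.+1)%N ->
  (ord_size (pow_iter k n q) <= k.+1)%N /\
  coef (pow_iter k n q) k = (n + coef q k)%N.
Proof.
move=> qk; elim: n => //= n [h1 h2].
by rewrite ord_size_pow_addl// coef_pow_addl// h2.
Qed.

Lemma coef_pow_iter0 k n l :
  coef (pow_iter k n 0%:O) l = if l == k then n else 0.
Proof.
have [h1 h2] := @coef_pow_iter k n 0%:O ltac:(rewrite ord_size0; lia).
case: eqP => [->|lk]; first by rewrite h2 Defs.coef0 addn0.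
elim: n {h1 h2} => [|n IH]; first exact: Defs.coef0.
by rewrite /= coef_add coef_omega_pow IH (introF eqP lk); do ?case: ifP.
Qed.

(** Adding omega^k on the right erases the terms of [p] of degree less than k, i.e. rounds [p] up to
    the next multiple of omega^k. *)
Lemma add_pow_iter k p : (ord_size p <= k.+1)%N ->
  p +o omega_pow k = pow_iter k (coef p k).+1 0%:O.
Proof.
move=> pk; apply: coefP => l.
rewrite coef_add ord_size_omega_pow coef_omega_pow coef_pow_iter0 eqSS.
rewrite ltnS; case: (ltngtP l k) => [//|lk|->]; last by rewrite addn1.
by rewrite coef_ge_size//; lia.
Qed.

(* A set of pairs below omega^(k+1) which is stable, outside of a square, under
   translations of its blocks and which contains one point outside of that
   square contains all of them: all blocks outside of the square get the same
   pattern, and that pattern is everything. *)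
Lemma spread k (P : ord -> ord -> Prop) N :
  let le p := (ord_size p <= k.+1)%N in
  let far p q := (N <= coef p k)%N || (N <= coef q k)%N in
  (forall p q, le p -> le q -> far p q -> P p q -> P p (omega_pow k +o q)) ->
  (forall p q, le p -> le q -> far p (omega_pow k +o q) ->
     P p (omega_pow k +o q) -> P p q) ->
  (forall p q, le p -> le q -> far (omega_pow k +o p) q ->
     P (omega_pow k +o p) q -> P p q) ->
  (forall p q, (ord_size p <= k)%N -> le q -> far p q -> P p q ->
     P 0%:O (q +o omega_pow k)) ->
  (forall c, le c -> exists n, forall m, (n <= m)%N ->
     P 0%:O (pow_iter k m 0%:O) -> P c (pow_iter k m 0%:O)) ->
  (forall d, le d -> exists n, forall p, le p -> (n <= coef p k)%N ->
     P p 0%:O -> P p d) ->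
  (exists p q, [/\ le p, le q, far p q & P p q]) ->
  forall p q, le p -> le q -> far p q -> P p q.
Proof.
move=> le far up_r down_r down_l cross left0 right0 [p0 [q0 [lp0 lq0 far0 P0]]].
have le0 : le 0%:O by rewrite /le ord_size0.
have lower_r n p q : le p -> le q -> far p q -> P p (pow_iter k n q) -> P p q.
  move=> lp lq pq; elim: n => //= n IH h; apply: IH.
  have [h1 h2] := coef_pow_iter n lq.
  apply: down_r => //; rewrite /far coef_pow_addl// h2.
  by move: pq; rewrite /far; lia.
have lower_l n p q : le p -> le q -> far p q -> P (pow_iter k n p) q -> P p q.
  move=> lp lq pq; elim: n => //= n IH h; apply: IH.
  have [h1 h2] := coef_pow_iter n lp.
  apply: down_l => //; rewrite /far coef_pow_addl// h2.
  by move: pq; rewrite /far; lia.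
have raise_r n p q : le p -> le q -> far p q -> P p q -> P p (pow_iter k n q).
  move=> lp lq pq h; elim: n => //= n IH.
  have [h1 h2] := coef_pow_iter n lq.
  by apply: up_r => //; move: pq; rewrite /far h2; lia.
have axis m : (N <= m)%N -> P 0%:O (pow_iter k m 0%:O).
  have base : exists2 m, (N <= m)%N & P 0%:O (pow_iter k m 0%:O).
    (* With [q0] raised by N blocks the pair stays outside of the square whatever its first
       coordinate, so [p0] can be stripped of its blocks until [cross] applies. *)
    have := raise_r N _ _ lp0 lq0 far0 P0.
    have [] := coef_pow_iter N lq0; move: (pow_iter k N q0) => q1 lq1 cq1.
    have {cq1} : (N <= coef q1 k)%N by lia.
    move: q1 lq1; move ec: (coef p0 k) => c.
    elim: c p0 lp0 ec {far0 P0} => [|c IH] p lp ec q lq Nq h.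
      exists (coef q k).+1; first lia.
      rewrite -add_pow_iter//; apply: (cross p) => //; last first.
        by rewrite /far Nq orbT.
      rewrite leqNgt; apply/negP => kp.
      by have := @coef_lead p k ltac:(rewrite /le in lp; lia); lia.
    have [p' pe lp'] := coef_pow_subl lp ltac:(lia).
    apply: (IH p' lp' _ q lq Nq).
      by move: ec; rewrite pe coef_pow_addl//; lia.
    by apply: down_l => //; [rewrite /far Nq orbT|rewrite -pe].
  case: base => m0 Nm0 h0 Nm.
  have [l0 c0] := coef_pow_iter m0 le0.
  have := raise_r m _ _ le0 l0 _ h0; rewrite /far c0 Defs.coef0 addn0 Nm0 orbT.
  move=> /(_ isT); rewrite /pow_iter -iterD addnC iterD.
  have [l1 c1] := coef_pow_iter m le0.
  by apply: lower_r => //; rewrite /far c1 Defs.coef0 addn0 Nm orbT.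
have row p : le p -> P p (pow_iter k N 0%:O).
  move=> lp; have [n hn] := left0 p lp.
  (* The n extra blocks meet the threshold of [left0] and are stripped afterwards. *)
  have := hn (n + N)%N ltac:(lia) (axis (n + N)%N ltac:(lia)).
  have [l1 c1] := coef_pow_iter N le0.
  rewrite /pow_iter iterD; apply: lower_r => //.
  by rewrite /far c1; lia.
have right p d : le p -> le d -> (N <= coef p k)%N -> P p d.
  move=> lp ld Np; have [n hn] := right0 d ld.
  have [l1 c1] := coef_pow_iter n lp.
  (* [p] is raised past the threshold of [right0], the second coordinate goes from 0 to [d] there,
     and [p] is lowered back. *)
  apply: (lower_l n) => //; first by rewrite /far Np.
  apply: hn => //; first lia.
  apply: (lower_r N) => //; first by rewrite /far c1; lia.
  exact: row.
move=> p q lp lq pq; have [l1 c1] := coef_pow_iter N lp.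
apply: (lower_l N) => //; apply: right => //; lia.
Qed.

(** These are the ordinals of the form [omega^j c], including 0. *)
Definition low_coef0 j (a : ord) := forall l, (l < j)%N -> coef a l = 0.

Lemma low_coef0_addr j p u : low_coef0 j (p +o u) -> low_coef0 j u.
Proof.
move=> h l lj; have := h l lj; rewrite coef_add.
case: ifP => // h1; case: ifP => h2; first lia.
by rewrite (@coef_ge_size u)//; lia.
Qed.

Lemma low_coef0_add j p u : u <> 0%:O -> low_coef0 j u -> low_coef0 j (p +o u).
Proof.
move=> /eqP; rewrite -ord_size_eq0 => u0 h l lj; rewrite coef_add.
have := @coef_lead u (ord_size u).-1 ltac:(lia).
case: ifP => [_ _|h1]; first exact: h.
case: (ltnP (ord_size u).-1 j) => [/h ->//|]; lia.
Qed.

(** Adding omega^j on the right is not injective in general, but to such ordinals it does nothing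
    except increment the coefficient of index j. *)
Lemma low_coef0_inj j a b : low_coef0 j a -> low_coef0 j b ->
  a +o omega_pow j = b +o omega_pow j -> a = b.
Proof.
move=> ha hb /(congr1 (fun c => coef c)) e; apply: coefP => l.
have := congr1 (fun f => f l) e; rewrite /= !coef_add ord_size_omega_pow ltnS.
case: ltngtP => [lj _|jl|->]; first by rewrite ha ?hb.
  by rewrite eqSS gtn_eqF.
by rewrite eqxx coef_omega_pow eqxx; lia.
Qed.

(* In the second case (p,q) lies above (a,b). *)
Lemma translate_cancel j a b p q t : low_coef0 j a -> low_coef0 j b ->
  a +o omega_pow j = p +o t -> b +o omega_pow j = q +o t ->
  (a <= p)%O \/ exists u, a = p +o u /\ b = q +o u.
Proof.
move=> ha hb ea eb; case: (leP a p) => [|pa]; [by left|right].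
have [u e] := ord_sub_exists (ltW pa); exists u; split=> //.
have u0 : u <> 0%:O by move=> u0; move: pa; rewrite e u0 ord_addr0 ltxx.
have hu : low_coef0 j u by apply: (@low_coef0_addr _ p); rewrite -e.
have et : u +o omega_pow j = t by apply: (@ord_addI p); rewrite ord_addA -e.
apply: (@low_coef0_inj j) => //; first exact: low_coef0_add.
by rewrite eb -et ord_addA.
Qed.

Lemma low_coef0_split j a : low_coef0 j a -> (0 < coef a j)%N ->
  exists2 b, a = b +o omega_pow j & low_coef0 j b.
Proof.
move=> ha aj.
have ja := coef_gt0_size aj.
pose b : ord := (\poly_(i < ord_size a)
  if i == j then (coef a j).-1 else coef a i)%R.
have bE i : coef b i = if i == j then (coef a j).-1 else coef a i.
  rewrite /coef coef_poly -/(coef a j) -/(coef a i).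
  case: ltnP => // ai; case: eqP => [ij|_]; first by lia.
  by rewrite coef_ge_size.
exists b; last by move=> l lj; rewrite bE ltn_eqF// ha.
apply: coefP => l; rewrite coef_add ord_size_omega_pow ltnS eqSS coef_omega_pow.
by rewrite bE; case: ltngtP => [lj|//|->]; [rewrite ha|lia].
Qed.

Lemma opens_nbhs (T : choiceType) (tau : topology T) (U : set T) (x : T) :
  opens tau U -> U x -> nbhs (x : topologized tau) U.
Proof. by move=> oU Ux; apply: open_nbhs_nbhs. Qed.

(** * The natural partial order and the topologies tau_i *)

Section Order.
Variable alpha : ord.
Local Notation B := (bicyclic alpha).
Implicit Types (x y z w : B) (i : ord).

Definition pt (a b : ord) : B := insubd (bicyclic_one alpha) (a, b).

Lemma val_pt a b : lt_omega_pow alpha a -> lt_omega_pow alpha b ->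
  val (pt a b) = (a, b).
Proof. by move=> ha hb; rewrite /pt insubdK// unfold_in/= ha hb. Qed.

Lemma bicyclic_lt x :
  lt_omega_pow alpha (val x).1 /\ lt_omega_pow alpha (val x).2.
Proof. by apply/andP; exact: (valP x). Qed.

Lemma val_mul x y : val (x * y)%g = pair_mul (val x) (val y).
Proof. by []. Qed.

Lemma val_one : val (1%g : B) = (0%:O, 0%:O).
Proof. by []. Qed.

Lemma pair_mull a b u d : pair_mul (a, b) (b +o u, d) = (a +o u, d).
Proof. by rewrite /pair_mul/= ord_le_addr ord_addKC. Qed.

Lemma pair_mulr a c u d : pair_mul (a, c +o u) (c, d) = (a, d +o u).
Proof.
rewrite /pair_mul/=; case: ifP => [h|_]; last by rewrite ord_addKC.
have e : c +o u = c by apply/eqP; rewrite eq_le h ord_le_addr.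
have u0 := ord_add_eq_self e.
by rewrite u0 !ord_addr0 -{1}(ord_addr0 c) ord_addKC ord_addr0.
Qed.

(* For i >= alpha, [up i x] is the principal filter of x in the natural partial
   order of the inverse monoid B_alpha; for i < alpha that order is cut off at
   omega^i, which isolates the points (omega^j, omega^j) with j >= i. *)
Definition up i x : set B :=
  [set y | exists2 t, lt_omega_pow i t &
     val x = ((val y).1 +o t, (val y).2 +o t)].

Lemma up_refl i x : up i x x.
Proof.
exists 0%:O; first exact: lt_omega_pow0.
by rewrite !ord_addr0 -surjective_pairing.
Qed.

Lemma up_trans i x y z : up i x y -> up i y z -> up i x z.
Proof.
move=> [t ht ex] [s hs ey]; exists (s +o t); first exact: lt_omega_pow_add.
by rewrite ex ey /= !ord_addA.
Qed.

Lemma up_full i x y : up i x y -> up omega x y.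
Proof. by move=> [t _ e]; exists t => //; exact: lt_omega_pow_omega. Qed.

Lemma up_anti i x y : up i x y -> up i y x -> x = y.
Proof.
move=> [t _ ex] [s _ ey]; apply: val_inj; rewrite ex.
suff -> : t = 0%:O by rewrite !ord_addr0 -surjective_pairing.
apply: (@ord_add_eq0r s); apply: (@ord_add_eq_self (val x).1).
have e1 : (val y).1 = (val x).1 +o s by rewrite ey.
have e2 : (val x).1 = (val y).1 +o t by rewrite ex.
by rewrite ord_addA -e1 -e2.
Qed.

(** The differences of [x] and [y] from [z] are comparable ordinals; if that of [x] is the longer
    one, both its parts stay below omega^i. *)
Lemma up_laminar i x y z : up i x z -> up omega y z ->
  up omega y x \/ (up i x y /\ up i y z).
Proof.
move=> [t ht ex] [s _ ey]; case: (ord_cmp t s) => -[u e].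
  left; exists u; first exact: lt_omega_pow_omega.
  by rewrite ey ex e /= !ord_addA.
right; split.
  exists u; first by move: ht; rewrite e; exact: lt_omega_pow_addr.
  by rewrite ey ex e /= !ord_addA.
by exists s => //; move: ht; rewrite e; exact: lt_omega_pow_addl.
Qed.

Lemma up_laminar_same i x y z : up i x z -> up i y z -> up i x y \/ up i y x.
Proof.
move=> [t ht ex] [s hs ey]; case: (ord_cmp t s) => -[u e]; [right|left];
  exists u; rewrite ?ex ?ey ?e /= ?ord_addA//.
  by move: hs; rewrite e; exact: lt_omega_pow_addr.
by move: ht; rewrite e; exact: lt_omega_pow_addr.
Qed.

(* Translations are residuated for the natural order; translating may shorten
   the difference, hence the two cases for the truncated order. *)
Lemma up_mull i (s w : B) : (forall x, ~ up i w (s * x)%g) \/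
  exists i' w', (i' = i \/ i' = omega) /\
    forall x, up i w (s * x)%g <-> up i' w' x.
Proof.
case es: (val s) => [c d]; case ew: (val w) => [a b].
have [_ hd] := bicyclic_lt s; have [ha hb] := bicyclic_lt w.
rewrite es ew /= in hd ha hb.
case: (leP c a) => [/ord_sub_exists[v e]|ac]; last first.
  left=> x [t _]; rewrite val_mul es ew /pair_mul => -[+ _].
  apply/eqP; apply/negP => /eqP e; move: ac; rewrite e ltNge.
  by case: ifP => _ /=; rewrite -?ord_addA ord_le_addr.
have hv : lt_omega_pow alpha v by move: ha; rewrite e; exact: lt_omega_pow_addr.
(* If [v] is below omega^i, so is every difference arising for [s * x], being a right part of [v],
   while that for [x] may be longer: the full order is needed. Otherwise the bound holds on one side
   iff it holds on the other. *)
right; exists (if lt_omega_pow i v then omega else i), (pt (d +o v) b).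
split; first by case: ifP; auto.
move=> x; rewrite /up/= ew val_pt//; last exact: lt_omega_pow_add.
case: (val x) => p q.
case: (ord_cmp d p) => -[u eu].
  rewrite es eu pair_mull /= e.
  split=> [[t ht [+ bt]]|[t ht [+ bt]]]; rewrite -ord_addA => /ord_addI vt;
    exists t.
  - by case: ifP => // _; exact: lt_omega_pow_omega.
  - by rewrite vt bt ord_addA.
  - by move: ht; case: ifP => // + _; rewrite vt; exact: lt_omega_pow_addr.
  - by rewrite vt bt ord_addA.
rewrite es eu pair_mulr /= e; split=> [[t ht [/ord_addI vt bt]]|].
  exists (u +o v); first by rewrite vt ht; exact: lt_omega_pow_omega.
  by rewrite bt vt !ord_addA.
move=> [t ht [+ bt]]; rewrite -ord_addA => /ord_addI vt.
exists v; last by rewrite bt -vt ord_addA.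
apply: contraT => nv; move: ht; rewrite (negbTE nv) -vt => /lt_omega_pow_addr.
by rewrite (negbTE nv).
Qed.

Fact swap_subproof x :
  let p := ((val x).2, (val x).1) in
  lt_omega_pow alpha p.1 && lt_omega_pow alpha p.2.
Proof. by have [h1 h2] := bicyclic_lt x; rewrite /= h1 h2. Qed.

(** Inversion in the inverse monoid: an order-preserving anti-automorphism, which reduces right
    translations to left ones. *)
Definition swap x : B := Sub ((val x).2, (val x).1) (swap_subproof x).

Lemma swapK : involutive swap.
Proof. by move=> x; apply: val_inj; rewrite /= -surjective_pairing. Qed.

Lemma swap_mul x y : swap (x * y)%g = (swap y * swap x)%g.
Proof.
apply: val_inj; rewrite /= /swap/=; case: (val x) (val y) => a b [c d].
by case: (ord_cmp b c) => -[u ->]; rewrite ?pair_mull ?pair_mulr.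
Qed.

Lemma up_swap i x y : up i (swap x) (swap y) <-> up i x y.
Proof.
rewrite /up/=; case: (val x) (val y) => a b [c d] /=.
by split=> -[t ht [-> ->]]; exists t.
Qed.

Lemma up_mulr i (s w : B) : (forall x, ~ up i w (x * s)%g) \/
  exists i' w', (i' = i \/ i' = omega) /\
    forall x, up i w (x * s)%g <-> up i' w' x.
Proof.
have e x : up i w (x * s)%g <-> up i (swap w) (swap s * swap x)%g.
  by rewrite -swap_mul; split=> /up_swap.
case: (up_mull i (swap s) (swap w)) => [h|[i' [w' [hi h]]]].
  by left=> x /e /h.
right; exists i', (swap w'); split=> // x.
rewrite e h; rewrite -{1}(swapK w'); exact: up_swap.
Qed.

(** By transitivity [up i x] is contained in each [up i v] to which [x] belongs; so finite
    intersections of the declared clopen sets reduce, near [x], to [up i x] minus finitely many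
    up-sets that miss [x]. *)
Definition sigma_opens i : set (set B) :=
  [set U | forall x, U x -> exists2 S : seq B, (forall w, w \in S -> ~ up i w x)
     & forall y, up i x y -> (forall w, w \in S -> ~ up i w y) -> U y].

Fact sigma_opensT i : sigma_opens i [set: B].
Proof. by move=> x _; exists [::]. Qed.

Fact sigma_opensI i : setI_closed (sigma_opens i).
Proof.
move=> U V oU oV x [/oU[S Sx SU] /oV[S' Sx' SV]].
exists (S ++ S') => [w|y xy hy].
  by rewrite mem_cat => /orP[/Sx|/Sx'].
by split; [apply: SU|apply: SV] => // w wS; apply: hy; rewrite mem_cat wS ?orbT.
Qed.

Fact sigma_opens_bigcup i (F : set (set B)) : F `<=` sigma_opens i ->
  sigma_opens i (\bigcup_(A in F) A).
Proof.
move=> FO x [A FA Ax]; have [S Sx SA] := FO A FA x Ax.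
by exists S => // y xy hy; exists A => //; exact: SA.
Qed.

Definition sigma i : topology B :=
  Topology (@sigma_opensT i) (@sigma_opensI i) (@sigma_opens_bigcup i).

Lemma sigma_open_up i w : opens (sigma i) (up i w).
Proof. by move=> x wx; exists [::] => // y xy _; exact: up_trans xy. Qed.

Lemma sigma_openC_up i w : opens (sigma i) (~` up i w).
Proof.
move=> x wx; exists [:: w] => [v|y _ hy]; first by rewrite inE => /eqP ->.
by apply: hy; rewrite inE.
Qed.

Lemma sigma_open_full i w : opens (sigma i) (up omega w).
Proof.
move=> x wx; exists [::] => // y xy _; apply: up_trans wx _.
exact: up_full xy.
Qed.

(** If [x] is outside of the full up-set of [w], the tree property puts every common point of that
    set and [up i x] into [up i w], so removing [up i w] suffices. *)
Lemma sigma_openC_full i w : opens (sigma i) (~` up omega w).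
Proof.
move=> x wx; exists [:: w] => [v|y xy hy wy].
  by rewrite inE => /eqP -> /up_full.
have wy' : ~ up i w y by apply: hy; rewrite inE.
by case: (up_laminar xy wy) => [//|[_]].
Qed.

Lemma sigma_hausdorff i : hausdorff_space (topologized (sigma i)).
Proof.
rewrite open_hausdorff => x y xy.
have sep (u v : B) : ~ up i u v -> [/\ opens (sigma i) (up i u),
    opens (sigma i) (~` up i u), up i u u & (~` up i u) v].
  move=> nxy; split=> //; first exact: sigma_open_up.
    exact: sigma_openC_up.
  exact: up_refl.
case: (pselect (up i x y)) => [uxy|/sep[h1 h2 h3 h4]].
  have /sep[h1 h2 h3 h4] : ~ up i y x.
    by move=> /(up_anti uxy) e; move/eqP: xy.
  exists (~` up i y, up i y) => /=; first by rewrite !inE.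
  by split=> //; apply/eqP; exact: setICl.
exists (up i x, ~` up i x) => /=; first by rewrite !inE.
by split=> //; apply/eqP; exact: setICr.
Qed.

(** An ultrafilter containing [up i x] converges to the point with least first coordinate among
    those whose up-sets belong to it. *)
Lemma sigma_compact_up i x : compact (up i x : set (topologized (sigma i))).
Proof.
rewrite compact_ultra => F UF Fx.
pose D : set B := [set y | F (up i y)].
have [y [Dy ymin]] : exists y, D y /\
    forall w, D w -> ((val y).1 <= (val w).1)%O.
  have : exists a, exists2 y, D y & (val y).1 = a by exists (val x).1, x.
  move=> [a]; elim: (ord_lt_wf a) => {}a _ IH [y Dy ya].
  case: (pselect (exists2 w, D w & ((val w).1 < a)%O)) => [[w Dw wa]|nD].
    by apply: (IH _ wa); exists w.
  exists y; split=> // w Dw; rewrite leNgt; apply/negP => wy.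
  by apply: nD; exists w => //; rewrite -ya.
have below w : D w -> up i w y.
  move=> Dw; have [z [yz wz]] := filter_ex (filterI Dy Dw).
  case: (up_laminar_same yz wz) => // -[t ht ey].
  (* In the remaining case [y = w + t], and minimality forces [t = 0]. *)
  have e : (val w).1 +o t = (val w).1.
    apply/eqP; rewrite eq_le ord_le_addr andbT.
    by move: (ymin _ Dw); rewrite ey.
  suff -> : y = w by exact: up_refl.
  by apply: val_inj; rewrite ey (ord_add_eq_self e) !ord_addr0
    -surjective_pairing.
exists y; split; first exact: below.
move=> U; rewrite nbhsE => -[V [oV Vy] VU].
have [S Sy SV] := oV y Vy; apply: filterS VU _.
have : F (up i y `&` [set z | forall w, w \in S -> ~ up i w z]).
  apply: filterI => //; elim: S Sy {SV} => [|w S IH] Sy.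
    by apply: filterS (filterT : F setT).
  have FS := IH (fun v vS => Sy v (mem_behead (s := w :: S) vS)).
  have [Dw|FwC] := in_ultra_setVsetC (up i w) UF.
    by case: (Sy w) => //; [exact: mem_head|exact: below].
  apply: filterS (filterI FS FwC) => z [hS hw] v.
  by rewrite inE => /predU1P[->//|]; exact: hS.
by apply: filterS => z [yz hz]; exact: SV.
Qed.

Lemma sigma_locally_compact i : locally_compact [set: topologized (sigma i)].
Proof.
move=> x _; exists (up i x).
  apply: filterS (opens_nbhs (@sigma_open_up i x) (up_refl i x)) => y //.
split; first exact: sigma_compact_up.
by rewrite -openC; exact: sigma_openC_up.
Qed.

(** It suffices to test the up-sets generating the topology; preimages that are up-sets for the full
    order are harmless, since those are clopen too. *)
Lemma sigma_continuous i (f : B -> B) :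
  (forall w, (forall x, ~ up i w (f x)) \/ exists i' w', (i' = i \/ i' = omega)
    /\ forall x, up i w (f x) <-> up i' w' x) ->
  continuous (f : topologized (sigma i) -> topologized (sigma i)).
Proof.
move=> hf.
have oup w : opens (sigma i) (f @^-1` up i w).
  case: (hf w) => [h|[i' [w' [hi' h]]]].
    by move=> x /h.
  have -> : f @^-1` up i w = up i' w' by apply/seteqP; split=> x /h.
  by case: hi' => ->; [exact: sigma_open_up|exact: sigma_open_full].
have oupC w : opens (sigma i) (f @^-1` (~` up i w)).
  case: (hf w) => [h|[i' [w' [hi' h]]]].
    by move=> x _; exists [::] => // y _ _; exact: h.
  have -> : f @^-1` (~` up i w) = ~` up i' w'.
    by apply/seteqP; split=> x /= + /h.
  by case: hi' => ->; [exact: sigma_openC_up|exact: sigma_openC_full].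
move=> x U; rewrite nbhsE => -[V [oV Vx] VU].
have [S Sx SV] := oV _ Vx; rewrite nbhs_simpl/=.
have : nbhs (x : topologized (sigma i)) (f @^-1` up i (f x) `&`
    [set y | forall w, w \in S -> ~ up i w (f y)]).
  apply: filterI.
    by apply: opens_nbhs; [exact: oup|exact: up_refl].
  elim: S Sx {SV} => [|w S IH] Sx; first exact: filterS filterT.
  have FS := IH (fun v vS => Sx v (mem_behead (s := w :: S) vS)).
  have Fw : nbhs (x : topologized (sigma i)) (f @^-1` (~` up i w)).
    apply: opens_nbhs; first exact: oupC.
    by apply: Sx; exact: mem_head.
  apply: filterS (filterI FS Fw) => z [hS hw] v.
  by rewrite inE => /predU1P[->//|]; exact: hS.
by apply: filterS => y [xy hy]; apply: VU; apply: SV.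
Qed.

Lemma sigma_shift_continuous i : shift_continuous (sigma i).
Proof.
move=> a b; have ca := @sigma_continuous i (fun x => a * x)%g (up_mull i a).
have cb := @sigma_continuous i (fun x => x * b)%g (up_mulr i b).
by move=> x; apply: (continuous_comp (ca x) (cb _)).
Qed.

Lemma sigma_lc i : lc_shift_topologies B (sigma i).
Proof.
split; [exact: sigma_hausdorff|exact: sigma_locally_compact|].
exact: sigma_shift_continuous.
Qed.

End Order.

(** With j the least exponent in a nonzero difference [t], a final omega^j splits off both
    coordinates of [x], and no smaller power remains. *)
Lemma up_translate alpha (x y : bicyclic alpha) : up omega x y -> y <> x ->
  exists j a b (z : bicyclic alpha),
  [/\ low_coef0 j a, low_coef0 j b, val z = (omega_pow j, omega_pow j)
    & val x = (a +o omega_pow j, b +o omega_pow j)].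
Proof.
move=> [t _ ex] yx.
have t0 : t <> 0%:O.
  move=> t0; apply: yx; apply: val_inj.
  by rewrite ex t0 !ord_addr0 -surjective_pairing.
have st : (0 < ord_size t)%N by rewrite lt0n ord_size_eq0; apply/eqP.
have ext : exists j, (0 < coef t j)%N.
  by exists (ord_size t).-1; apply: coef_lead; lia.
case: (ex_minnP ext) => j tj minj.
have ht : low_coef0 j t.
  move=> l lj; apply/eqP; rewrite -leqn0 leqNgt; apply/negP => /minj; lia.
have hp p : low_coef0 j (p +o t) /\ (0 < coef (p +o t) j)%N.
  split; first exact: low_coef0_add.
  rewrite coef_add; case: ifP => // h1; case: ifP => [_|h2]; first lia.
  by move: (coef_gt0_size tj); lia.
have [xa xb] := bicyclic_lt x; rewrite ex /= in xa xb.
have [h1 h2] := hp (val y).1; have [h3 h4] := hp (val y).2.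
have [a ea ha] := low_coef0_split h1 h2.
have [b eb hb] := low_coef0_split h3 h4.
exists j, a, b, (pt alpha (omega_pow j) (omega_pow j)).
split=> //; last by rewrite ex ea eb.
by rewrite val_pt//; move: xa; rewrite ea; exact: lt_omega_pow_addr.
Qed.

Section CornerBound.
Variables (alpha : ord) (k : nat) (z : bicyclic alpha).
Hypothesis vz : val z = (omega_pow k.+1, omega_pow k.+1).

Lemma corner_lt : (k.+1%:O < alpha)%O.
Proof. by have [] := bicyclic_lt z; rewrite vz lt_omega_pow_pow. Qed.

Lemma lt_corner a : (ord_size a <= k.+1)%N -> lt_omega_pow alpha a.
Proof. by move=> h; apply: (lt_omega_pow_small corner_lt); lia. Qed.

End CornerBound.

(** * Hausdorff shift-continuous topologies *)

Section ShiftContinuous.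
Variables (alpha : ord) (alpha_ge1 : (1%:O <= alpha)%O).
Local Notation B := (bicyclic alpha).
Variable tau : topology B.
Hypotheses (tauH : hausdorff_space (topologized tau))
  (tauC : shift_continuous tau).
Implicit Types (x y z w : B).

Lemma shift_open (s s' : B) (U : set B) : opens tau U ->
  opens tau [set x | U (s * x * s')%g].
Proof. by move=> oU; have /continuousP := @tauC s s'; exact. Qed.

Lemma shift_nbhs (s s' x : B) (U : set B) :
  nbhs ((s * x * s')%g : topologized tau) U ->
  nbhs (x : topologized tau) [set y | U (s * y * s')%g].
Proof. by move=> xU; exact: (@tauC s s' x). Qed.

Lemma shift_neq_open (s s' : B) : opens tau [set x | (s * x * s')%g <> x].
Proof.
rewrite -open_topologized openE => x /= /eqP sx.
move: tauH; rewrite open_hausdorff => /(_ _ _ sx) [[U V]/= []].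
rewrite !inE => Ux Vx [oU oV /seteqP[UV0 _]].
apply: filterS (filterI (opens_nbhs (shift_open s s' oU) Ux)
  (opens_nbhs oV Vx)) => y /= [Uy Vy] e.
by apply: (UV0 y); split=> //; rewrite -e.
Qed.

Let lt1 : lt_omega_pow alpha 1%:O.
Proof.
apply: (@lt_omega_pow_size _ _ (omega_pow 0)); first by rewrite ord_pow0.
rewrite lt_omega_pow_pow; apply: lt_le_trans alpha_ge1.
by rewrite ord_nat_lt.
Qed.

(* (0,0) is the only point moved by both the left and the right multiplication
   by the idempotent (1,1). *)
Lemma open_one : opens tau [set (1%g : B)].
Proof.
pose e := pt alpha 1%:O 1%:O.
have ve : val e = (1%:O, 1%:O) by rewrite val_pt.
have n10 : 1%:O <> 0%:O by move=> h; have := ord_nat_lt 0 1; rewrite h ltxx.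
have -> : [set (1%g : B)] =
    [set x | (e * x * 1)%g <> x] `&` [set x | (1 * x * e)%g <> x].
  apply/seteqP; split=> [_ -> /=|x /= []].
    rewrite !mulg1 mul1g; suff: e <> 1%g by split.
    by move/(congr1 val); rewrite ve val_one => -[].
  rewrite mulg1 mul1g => h1 h2; apply: val_inj; rewrite val_one.
  case ex: (val x) => [p q].
  have [p0|p0] := eqVneq p 0%:O; last first.
    have /ord_sub_exists[u pu] : (1%:O <= p)%O by rewrite leNgt ord_lt1.
    by case: h1; apply: val_inj; rewrite val_mul ve ex pu pair_mull.
  have [q0|q0] := eqVneq q 0%:O; first by rewrite p0 q0.
  have /ord_sub_exists[u qu] : (1%:O <= q)%O by rewrite leNgt ord_lt1.
  by case: h2; apply: val_inj; rewrite val_mul ve ex qu pair_mulr.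
by apply: (@opensI _ tau); exact: shift_neq_open.
Qed.

(** For [w = (a,b)] and [x = (p,q)], the left factor moves the difference of [a] and [p] onto [q],
    and the right factor compares the result with [b]. *)
Lemma upE (w x : B) : up omega w x <->
  (pt alpha 0%:O (val w).1 * x * pt alpha (val w).2 0%:O)%g = 1%g.
Proof.
have [wa wb] := bicyclic_lt w.
have lt0 := lt_omega_pow0 alpha.
have -> (y : B) : y = 1%g <-> val y = (0%:O, 0%:O).
  by split=> [->//|e]; apply: val_inj.
rewrite !val_mul !val_pt// /up/=.
case: (val w) (val x) => a b [p q] /= {wa wb lt0}.
split=> [[t _ [-> ->]]|].
  by rewrite pair_mulr -{2}[q +o t]ord_addr0 pair_mull ord_addr0.
case: (ord_cmp p a) => -[u ->].
  rewrite pair_mulr => h; exists u; first exact: lt_omega_pow_omega.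
  congr (_, _); move: h; case: (ord_cmp (q +o u) b) => -[v e].
    by rewrite e pair_mull => -[/ord_add_eq0r ->]; rewrite ord_addr0.
  by rewrite {1}e pair_mulr => -[/ord_add_eq0r v0]; rewrite e v0 ord_addr0.
rewrite pair_mull ord_add0r => h; suff u0 : u = 0%:O.
  exists 0%:O; first exact: lt_omega_pow0.
  congr (_, _); first by rewrite u0 !ord_addr0.
  rewrite ord_addr0; move: h; rewrite u0; case: (ord_cmp q b) => -[v e].
    by rewrite e pair_mull => -[/ord_add_eq0r ->]; rewrite ord_addr0.
  by rewrite {1}e pair_mulr => -[/ord_add_eq0r v0]; rewrite e v0 ord_addr0.
move: h; case: (ord_cmp q b) => -[v ->]; last by rewrite pair_mulr => -[].
rewrite pair_mull => -[h]; apply/eqP; rewrite -ord_size_eq0.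
by move: (ord_size_add u v); rewrite h ord_size0; lia.
Qed.

Lemma open_up (w : B) : opens tau (up omega w).
Proof.
suff -> : up omega w = [set x | [set (1%g : B)]
    (pt alpha 0%:O (val w).1 * x * pt alpha (val w).2 0%:O)%g].
  exact/shift_open/open_one.
by apply/seteqP; split=> x /upE.
Qed.

Lemma openC_up (w : B) : opens tau (~` up omega w).
Proof.
suff -> : ~` up omega w = [set x | (~` [set (1%g : B)])
    (pt alpha 0%:O (val w).1 * x * pt alpha (val w).2 0%:O)%g].
  apply: shift_open; rewrite -open_topologized openC.
  apply: accessible_closed_set1; exact: hausdorff_accessible.
by apply/seteqP; split=> x /= + /upE.
Qed.

(* A variant of [tau_nbhd] that is a union of translates of the block of pairs
   below omega^k, and that does not contain (omega^(k+1), omega^(k+1)). *)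
Definition far k n : set B := [set x |
  [/\ (ord_size (val x).1 <= k.+1)%N, (ord_size (val x).2 <= k.+1)%N
    & (n <= coef (val x).1 k)%N || (n <= coef (val x).2 k)%N]].

Lemma far_le k m n x : (m <= n)%N -> far k n x -> far k m x.
Proof. by move=> mn [h1 h2 h3]; split=> //; lia. Qed.

(** * Neighbourhoods of the points z_(k+1) *)

Section Corner.
Variables (k : nat) (z : B).
Hypothesis vz : val z = (omega_pow k.+1, omega_pow k.+1).

Lemma up_corner x : up omega z x <-> x = z \/ far k 0 x.
Proof.
rewrite /up /far vz/=; split=> [[t _ [e1 e2]]|[->|[h1 h2 _]]].
- case: (ord_add_eq_pow (esym e1)) => -[x1 t1].
    rewrite t1 ord_addr0 in e2; left; apply: val_inj.
    by rewrite vz [val x]surjective_pairing x1 -e2.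
  case: (ord_add_eq_pow (esym e2)) => -[x2 t2]; last by right.
  move/esym/eqP: t1; rewrite t2.
  by rewrite -ord_size_eq0 ord_size_omega_pow.
- exists 0%:O; first exact: lt_omega_pow0.
  by rewrite vz !ord_addr0.
- exists (omega_pow k.+1); first exact: lt_omega_pow_omega.
  by rewrite !ord_add_absorb.
Qed.

(** Rounding up to multiples of omega^k shows that a pair with both coefficients below n lies in the
    up-set of some [(m omega^k, m' omega^k)] with m, m' at most n. These finitely many up-sets are
    closed and miss [z]. *)
Lemma far_nbhs n : nbhs (z : topologized tau) [set x | x = z \/ far k n x].
Proof.
pose c (m : 'I_n.+1) := pow_iter k m 0%:O.
have sc m : (ord_size (c m) <= k.+1)%N.
  by case: (@coef_pow_iter k m 0%:O); rewrite ?ord_size0.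
have vc m m' : val (pt alpha (c m) (c m')) = (c m, c m').
  by rewrite val_pt; [| exact: (lt_corner vz)..].
have hz m m' : nbhs (z : topologized tau) (~` up omega (pt alpha (c m) (c m'))).
  apply: opens_nbhs; first exact: openC_up.
  rewrite /up /= vc vz => -[t _ [e _]].
  have := ord_size_add (omega_pow k.+1) t; rewrite -e ord_size_omega_pow.
  by have := sc m; lia.
have hn : nbhs (z : topologized tau)
    [set x | forall m m', ~ up omega (pt alpha (c m) (c m')) x].
  have FF := nbhs_filter (z : topologized tau).
  apply: (@filter_forall _ _ (fun m => [set x | forall m',
    ~ up omega (pt alpha (c m) (c m')) x]) _ FF) => m.
  by apply: (@filter_forall _ _ (fun m' =>
    ~` up omega (pt alpha (c m) (c m'))) _ FF) => m'; exact: hz.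
apply: filterS (filterI (opens_nbhs (open_up z) (up_refl omega z)) hn).
move=> x [/up_corner[->|[x1 x2 _]] hx]; [by left|right].
split=> //; apply: contrapT => /negP; rewrite negb_or -!ltnNge => /andP[n1 n2].
rewrite -ltnS in n1; rewrite -ltnS in n2.
apply: (hx (Ordinal n1) (Ordinal n2)).
exists (omega_pow k); first exact: lt_omega_pow_omega.
by rewrite vc /c /= !add_pow_iter.
Qed.

(** Otherwise the traces of [C] on the sets [far k n] cluster at some [y] in [C]; but the up-set of
    [y] is open, and its points have coefficients of index k at most those of [y]. *)
Lemma compact_far (C : set B) : compact (C : set (topologized tau)) ->
  C `<=` far k 0 -> exists n, forall x, C x -> ~ far k n x.
Proof.
move=> cC C0; apply: contrapT => nC.
have ne n : (C `&` far k n) !=set0.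
  apply: contrapT => h; apply: nC; exists n => x Cx fx; apply: h.
  by exists x.
pose F : set_system (topologized tau) :=
  filter_from setT (fun n => C `&` far k n).
have PF : ProperFilter F.
  apply: filter_from_proper => //; apply: filter_fromT_filter.
    by exists 0.
  move=> m n; exists (maxn m n) => x [Cx fx].
  by split; split=> //; apply: far_le fx; lia.
have [y [Cy Fy]] : C `&` cluster F !=set0.
  by apply: cC; exists 0 => // x [].
have [y1 y2 _] := C0 y Cy.
pose n := (coef (val y).1 k + coef (val y).2 k).+1.
have Fn : F (C `&` far k n) by exists n.
have [x [[_ [_ _ xn]] [t _ ey]]] :=
  Fy _ _ Fn (opens_nbhs (open_up y) (up_refl omega y)).
suff mono a : (ord_size (a +o t) <= k.+1)%N -> (coef a k <= coef (a +o t) k)%N.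
  move: xn; rewrite /n; have := mono (val x).1; have := mono (val x).2.
  by move: y1 y2; rewrite ey /=; lia.
rewrite ord_size_add coef_add => st; case: ifP => [|_]; first lia.
by case: ifP; lia.
Qed.

Hypothesis tauL : locally_compact [set: topologized tau].

(** The compact set will prevent smaller points z_j from being isolated; the last clause identifies
    the neighbourhood filter of [z]. *)
Lemma corner_base : ~ opens tau [set z] ->
  exists K : set B, [/\ compact (K : set (topologized tau)),
    exists n, far k n `<=` K
    & forall W, nbhs (z : topologized tau) W -> exists n, far k n `<=` W].
Proof.
move=> nz; have [//|K zK [cK clK]] := tauL (x := z).
have {}zK : nbhs (z : topologized tau) K.
  by move: zK; rewrite /within/=; apply: filterS => x /(_ I).
(* The part of [K] in the up-set of [z] and outside of the interior of [W] is compact and misses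
   [z], so [compact_far] bounds it. *)
have small W : nbhs (z : topologized tau) W ->
    exists n, forall x, K x -> far k n x -> W x.
  move=> zW; pose C := K `&` (up omega z `&`
    ~` interior (W : set (topologized tau))).
  have cC : compact (C : set (topologized tau)).
    apply: compact_closedI => //; apply: closedI.
      by rewrite -openC; exact: openC_up.
    by apply: open_closedC; exact: open_interior.
  have [|n hn] := compact_far cC.
    by move=> x [_ [/up_corner[->|//] nW]].
  exists n => x Kx fx; apply: contrapT => nW; apply: (hn x) => //.
  split=> //; split; first by apply/up_corner; right; apply: far_le fx.
  by move=> Wx; apply: nW; exact: interior_subset Wx.
have invariant s s' : (s * z * s')%g = z ->
    exists n, forall x, K x -> far k n x -> K (s * x * s')%g.
  move=> e; apply: (small [set x | K (s * x * s')%g]).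
  by apply: shift_nbhs; rewrite e.
have p1z a : (ord_size a <= k.+1)%N ->
    pair_mul (a, 0%:O) (omega_pow k.+1, omega_pow k.+1) =
    (omega_pow k.+1, omega_pow k.+1).
  by move=> ha; rewrite -{1}[omega_pow k.+1]ord_add0r pair_mull ord_add_absorb.
have p2z a : (ord_size a <= k.+1)%N ->
    pair_mul (0%:O, a) (omega_pow k.+1, omega_pow k.+1) =
    (omega_pow k.+1, omega_pow k.+1).
  by move=> ha; rewrite -{1}(ord_add_absorb ha) pair_mull ord_add0r.
have p3z a : (ord_size a <= k.+1)%N ->
    pair_mul (omega_pow k.+1, omega_pow k.+1) (0%:O, a) =
    (omega_pow k.+1, omega_pow k.+1).
  by move=> ha; rewrite -{2}[omega_pow k.+1]ord_add0r pair_mulr ord_add_absorb.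
have p4z a : (ord_size a <= k.+1)%N ->
    pair_mul (omega_pow k.+1, omega_pow k.+1) (a, 0%:O) =
    (omega_pow k.+1, omega_pow k.+1).
  by move=> ha; rewrite -{2}(ord_add_absorb ha) pair_mulr ord_add0r.
have lt0 := lt_omega_pow0 alpha.
have vpt a b : (ord_size a <= k.+1)%N -> (ord_size b <= k.+1)%N ->
    val (pt alpha a b) = (a, b).
  by move=> ha hb; rewrite val_pt//; exact: (lt_corner vz).
have s0 : (ord_size 0%:O <= k.+1)%N by rewrite ord_size0.
have se : (ord_size (omega_pow k) <= k.+1)%N by rewrite ord_size_omega_pow.
have left_z a b : (ord_size a <= k.+1)%N -> (ord_size b <= k.+1)%N ->
    a = 0%:O \/ b = 0%:O ->
    (pt alpha a b * z * 1)%g = z /\ (1 * z * pt alpha a b)%g = z.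
  move=> ha hb h0; split; apply: val_inj; rewrite ?mulg1 ?mul1g.
    rewrite val_mul vpt// vz; case: h0 => ->; [exact: p2z|exact: p1z].
  rewrite val_mul vpt// vz; case: h0 => ->; [exact: p3z|exact: p4z].
have ptE x a b : val x = (a, b) -> x = pt alpha a b.
  by move=> e; apply: val_inj; rewrite val_pt// -?e;
    have [] := bicyclic_lt x; rewrite e.
(* These three translations respectively strip a block from the first coordinate, add one to the
   second, and strip one from the second. *)
have [n1 h1] := invariant _ _ (left_z _ _ s0 se (or_introl erefl)).1.
have [n2 h2] := invariant _ _ (left_z _ _ s0 se (or_introl erefl)).2.
have [n3 h3] := invariant _ _ (left_z _ _ se s0 (or_intror erefl)).2.
pose N := maxn n1 (maxn n2 n3).
have farpt n a b : (ord_size a <= k.+1)%N -> (ord_size b <= k.+1)%N ->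
    (n <= coef a k)%N || (n <= coef b k)%N -> far k n (pt alpha a b).
  by move=> ha hb hn; rewrite /far/= vpt.
have Kpt x a b : K x -> val x = (a, b) -> K (pt alpha a b).
  by move=> Kx /ptE <-.
have farK : far k N `<=` K.
  have key : forall p q, (ord_size p <= k.+1)%N -> (ord_size q <= k.+1)%N ->
      (N <= coef p k)%N || (N <= coef q k)%N -> K (pt alpha p q).
    apply: (@spread k (fun p q => K (pt alpha p q)) N).
    - move=> p q hp hq hN Kpq.
      have fx : far k n2 (pt alpha p q) by apply: farpt => //; lia.
      apply: Kpt (h2 _ Kpq fx) _.
      by rewrite mul1g val_mul !vpt// -{1}[q]ord_add0r pair_mulr.
    - move=> p q hp hq hN Kpq.
      have hq' := ord_size_pow_addl hq.
      have fx : far k n3 (pt alpha p (omega_pow k +o q)).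
        by apply: farpt => //; lia.
      apply: Kpt (h3 _ Kpq fx) _.
      by rewrite mul1g val_mul !vpt// ?hq'// pair_mulr ord_add0r.
    - move=> p q hp hq hN Kpq.
      have hp' := ord_size_pow_addl hp.
      have fx : far k n1 (pt alpha (omega_pow k +o p) q).
        by apply: farpt => //; lia.
      apply: Kpt (h1 _ Kpq fx) _.
      by rewrite mulg1 val_mul !vpt// ?hp'// pair_mull ord_add0r.
    - move=> p q hp hq hN Kpq; have hp' : (ord_size p <= k.+1)%N by lia.
      have fx : far k n1 (pt alpha p q) by apply: farpt => //; lia.
      apply: Kpt (h1 _ Kpq fx) _.
      by rewrite mulg1 val_mul !vpt// -{1}(ord_add_absorb hp) pair_mulr.
    - move=> c hc.
      have [n hn] := invariant _ _ (left_z _ _ hc s0 (or_intror erefl)).1.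
      exists n => m nm Kpq; have [m1 m2] := coef_pow_iter m s0.
      have fx : far k n (pt alpha 0%:O (pow_iter k m 0%:O)).
        by apply: farpt => //; lia.
      apply: Kpt (hn _ Kpq fx) _.
      rewrite mulg1 val_mul !vpt// -[X in pair_mul _ (X, _)](ord_addr0 0%:O).
      by rewrite pair_mull ord_addr0.
    - move=> d hd.
      have [n hn] := invariant _ _ (left_z _ _ s0 hd (or_introl erefl)).2.
      exists n => p hp np Kpq.
      have fx : far k n (pt alpha p 0%:O) by apply: farpt => //; lia.
      apply: Kpt (hn _ Kpq fx) _.
      rewrite mul1g val_mul !vpt// -[X in pair_mul (_, X) _](ord_addr0 0%:O).
      by rewrite pair_mulr ord_addr0.
    (* If [K] had no point in [far k N], then [far_nbhs] would make [z] isolated. *)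
    - apply: contrapT => nex; apply: nz.
      rewrite -open_topologized openE => _ ->.
      apply: filterS (filterI zK (far_nbhs N)) => x [Kx [//|[x1 x2 xN]]].
      case: nex; exists (val x).1, (val x).2; split=> //.
      by apply: Kpt Kx _; rewrite -surjective_pairing.
  move=> x [x1 x2 xN]; rewrite (ptE x _ _ (surjective_pairing _)).
  exact: key.
exists K; split=> //; first by exists N.
move=> W /small[n hn]; exists (maxn n N) => x fx.
by apply: hn; [apply: farK|]; apply: far_le fx; lia.
Qed.

End Corner.

(** Prefixing N blocks omega^k makes every pair below omega^(m+1) far, so removing them by a left
    translation maps [K] onto a compact set containing all these pairs. If [y] were isolated, they
    would form a closed subset of it, namely the up-set of [y] without [y], against
    [compact_far]. *)
Lemma corner_lower (tauL : locally_compact [set: topologized tau]) k m z y :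
  val z = (omega_pow k.+1, omega_pow k.+1) ->
  val y = (omega_pow m.+1, omega_pow m.+1) -> (m < k)%N ->
  ~ opens tau [set z] -> ~ opens tau [set y].
Proof.
move=> vz vy mk nz oy; have [K [cK [N farK] _]] := corner_base vz tauL nz.
have s0 : (ord_size 0%:O <= k.+1)%N by rewrite ord_size0.
have [s1 c1] := coef_pow_iter N s0.
have lt0 := lt_omega_pow0 alpha.
have ltN : lt_omega_pow alpha (pow_iter k N 0%:O) by exact: lt_corner vz _ s1.
pose L x := (pt alpha 0%:O (pow_iter k N 0%:O) * x * 1)%g.
have cL : compact (L @` K : set (topologized tau)).
  apply: (@continuous_compact (topologized tau) (topologized tau) L) => //.
  by apply: continuous_subspaceT; exact: tauC.
have sub : far m 0 `<=` L @` K.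
  move=> x [+ + _]; have := bicyclic_lt x; case ex: (val x) => [p q] /=.
  move=> [lp lq] p1 q1; have lNp := lt_omega_pow_add ltN lp.
  exists (pt alpha (pow_iter k N 0%:O +o p) q).
    apply: farK; rewrite /far/= val_pt//= ord_size_add coef_add c1.
    split; try lia; case: ifP => [|_]; first lia.
    by case: ifP; lia.
  apply: val_inj; rewrite /L mulg1 val_mul !val_pt//.
  by rewrite pair_mull ord_add0r ex.
have cC : compact (far m 0 : set (topologized tau)).
  have -> : far m 0 = L @` K `&` (up omega y `&` ~` [set y]).
    apply/seteqP; split=> x => [fx|[_ [/up_corner]]]; last first.
      by move=> /(_ _ vy)[].
    split; first exact: sub.
    split; first by apply/up_corner; [exact: vy|right].
    move=> xy; case: fx => + _ _.
    by rewrite xy vy ord_size_omega_pow; lia.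
  apply: compact_closedI => //; apply: closedI.
    by rewrite -openC; exact: openC_up.
  by rewrite closedC.
have [n hn] := @compact_far m _ cC (fun x fx => fx).
have s0' : (ord_size 0%:O <= m.+1)%N by rewrite ord_size0.
have [s2 c2] := coef_pow_iter n s0'.
have fp i : (i <= n)%N -> far m i (pt alpha 0%:O (pow_iter m n 0%:O)).
  move=> ni; rewrite /far/= val_pt//=; last exact: (lt_corner vy).
  by split=> //; rewrite c2; lia.
exact: (hn _ (fp 0 _) (fp n _)).
Qed.

(** Multiplying by [(0,a)] and [(b,0)] sends [x] to [z], and this is undone by [(a,0)] and [(0,b)]
    on the points at least [(a,b)] coordinatewise. By [translate_cancel] these include the up-set of
    [x] minus that of [(a,b)], a neighbourhood of [x]. *)
Lemma nbhs_translate j a b z x (U : set B) :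
  low_coef0 j a -> low_coef0 j b ->
  val z = (omega_pow j, omega_pow j) ->
  val x = (a +o omega_pow j, b +o omega_pow j) ->
  nbhs (z : topologized tau)
    [set y | U (pt alpha a 0%:O * y * pt alpha 0%:O b)%g] ->
  nbhs (x : topologized tau) U.
Proof.
move=> ha hb vz vx zU.
have [xa xb] := bicyclic_lt x; rewrite vx /= in xa xb.
have la := lt_omega_pow_addl xa; have lb := lt_omega_pow_addl xb.
have lj := lt_omega_pow_addr xa; have lt0 := lt_omega_pow0 alpha.
pose w := pt alpha a b.
have vw : val w = (a, b) by rewrite val_pt.
have Lx : (pt alpha 0%:O a * x * pt alpha b 0%:O)%g = z.
  apply: val_inj; rewrite !val_mul !val_pt// vx vz pair_mull.
  by rewrite ord_add0r pair_mulr ord_add0r.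
move: zU; rewrite -{1}Lx => /shift_nbhs zU.
have nw : ~ up omega w x.
  move=> [t _]; rewrite vw vx /= => -[/esym + _].
  rewrite -ord_addA => /ord_add_eq_self/eqP; rewrite -ord_size_eq0.
  by rewrite ord_size_add ord_size_omega_pow; lia.
apply: filterS (filterI zU (filterI (opens_nbhs (open_up x) (up_refl omega x))
  (opens_nbhs (openC_up w) nw))) => y [/= Uy [[t _ ey] nwy]].
case ye : (val y) => [p q]; rewrite vx ye /= in ey; case: ey => ea eb.
have nu u : ~ (a = p +o u /\ b = q +o u).
  move=> [au bu]; apply: nwy; exists u; first exact: lt_omega_pow_omega.
  by rewrite vw ye au bu.
have ap : (a <= p)%O.
  by case: (translate_cancel ha hb ea eb) => // -[u /nu].
have bq : (b <= q)%O.
  by case: (translate_cancel hb ha eb ea) => // -[u [h1 h2]]; case: (nu u).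
move: ap bq => /ord_sub_exists[p' ep] /ord_sub_exists[q' eq].
suff -> : y = (pt alpha a 0%:O *
    (pt alpha 0%:O a * y * pt alpha b 0%:O) * pt alpha 0%:O b)%g by [].
apply: val_inj; rewrite !val_mul !val_pt// ye ep eq.
by rewrite pair_mull pair_mulr pair_mull pair_mulr.
Qed.

(** As omega^0 = 1, only the identity lies strictly above [z]. *)
Lemma open_corner0 z : val z = (omega_pow 0, omega_pow 0) -> opens tau [set z].
Proof.
move=> vz; suff -> : [set z] = up omega z `&` ~` up omega (1%g : B).
  by apply: (@opensI _ tau); [exact: open_up|exact: openC_up].
apply/seteqP; split=> [_ ->|x [[t _ + n1]]] /=.
  split; first exact: up_refl.
  move=> [t _]; rewrite val_one vz => -[/esym/(congr1 ord_size)].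
  by rewrite ord_size_add ord_size_omega_pow ord_size0; lia.
rewrite vz => -[e1 e2].
case: (ord_add_eq_pow (esym e1)) => -[x1 t1].
  rewrite t1 ord_addr0 in e2.
  by apply: val_inj; rewrite vz [val x]surjective_pairing x1 -e2.
case: (ord_add_eq_pow (esym e2)) => -[x2 t2].
  by move/eqP: t2; rewrite t1 -ord_size_eq0 ord_size_omega_pow.
case: n1; suff -> : x = 1%g by exact: up_refl.
have z0 a : (ord_size a <= 0)%N -> a = 0%:O.
  by rewrite leqn0 ord_size_eq0 => /eqP.
apply: val_inj.
by rewrite val_one [val x]surjective_pairing (z0 _ x1) (z0 _ x2).
Qed.

End ShiftContinuous.

(** A maximal point is isolated by its own up-set; any other point is a translate of some z_j, and
    z_0 is always isolated. *)
Lemma coarser_corner alpha (tau rho : topology (bicyclic alpha)) :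
  (1%:O <= alpha)%O ->
  hausdorff_space (topologized tau) -> shift_continuous tau ->
  hausdorff_space (topologized rho) -> shift_continuous rho ->
  (forall j (z : bicyclic alpha), (0 < j)%N ->
    val z = (omega_pow j, omega_pow j) ->
    nbhs (z : topologized tau) `<=` nbhs (z : topologized rho)) ->
  coarser tau rho.
Proof.
move=> a1 tauH tauC rhoH rhoC h U oU; rewrite -open_topologized openE => x Ux.
have [[y xy yx]|nx] := pselect (exists2 y, up omega x y & y <> x); last first.
  apply: filterS (opens_nbhs (open_up a1 rhoH rhoC x) (up_refl omega x)).
  move=> y xy; suff -> : y = x by [].
  by apply: contrapT => yx; apply: nx; exists y.
have [j [a [b [z [ha hb vz vx]]]]] := up_translate xy yx.
apply: (nbhs_translate a1 rhoH rhoC ha hb vz vx).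
have zU : nbhs (z : topologized tau)
    [set y | U (pt alpha a 0%:O * y * pt alpha 0%:O b)%g].
  apply: shift_nbhs => //; apply: opens_nbhs => //.
  suff <- : x = (pt alpha a 0%:O * z * pt alpha 0%:O b)%g by [].
  have [xa xb] := bicyclic_lt x; rewrite vx /= in xa xb.
  have la := lt_omega_pow_addl xa; have lb := lt_omega_pow_addl xb.
  have lt0 := lt_omega_pow0 alpha.
  apply: val_inj; rewrite !val_mul !val_pt// vx vz.
  have := pair_mull a 0%:O (omega_pow j) (omega_pow j).
  have := pair_mulr (a +o omega_pow j) 0%:O (omega_pow j) b.
  by rewrite ord_add0r => e ->; rewrite e.
case: j ha hb vz vx zU => [|j] _ _ vz _ zU; last exact: (h j.+1 z isT vz).
apply: filterS (opens_nbhs (open_corner0 a1 rhoH rhoC vz) erefl) => _ ->.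
exact: nbhs_singleton zU.
Qed.

(** * Classification *)

Lemma omega_pow_mul_lt n k a : (ord_size a <= k.+1)%N ->
  (n < coef a k)%N -> (omega_pow_mul n k < a)%O.
Proof.
move=> ak na; apply/ord_ltP; exists k; rewrite coef_omega_pow_mul eqxx.
split=> // l kl; rewrite coef_omega_pow_mul gtn_eqF// coef_ge_size//; lia.
Qed.

Lemma coef_ge_omega_pow_mul n k a : (ord_size a <= k.+1)%N ->
  (omega_pow_mul n k < a)%O -> (n <= coef a k)%N.
Proof.
move=> ak; apply: contraTT; rewrite -ltnNge -leNgt => an; apply/ltW/ord_ltP.
exists k; rewrite coef_omega_pow_mul eqxx.
split=> // l kl; rewrite coef_omega_pow_mul gtn_eqF// coef_ge_size//; lia.
Qed.

Section Classification.
Variables (alpha : ord) (alpha_ge1 : (1%:O <= alpha)%O).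
Local Notation B := (bicyclic alpha).
Implicit Types (x y z w : B) (tau rho : topology B) (i : ord).

(** The strict inequalities in [tau_nbhd] cost one: [n omega^k < a] only forces the coefficient to
    be at least n, so the two families interleave with a shift. *)
Lemma far_tau_nbhd k n : @far alpha k n.+1 `<=` tau_nbhd alpha k.+1 n.
Proof.
move=> x [+ +]; rewrite /tau_nbhd/=; case: (val x) => a b /= ha hb hn.
left; rewrite !lt_omega_powP; split=> //.
by case/orP: hn => hn; [left|right]; exact: omega_pow_mul_lt.
Qed.

Lemma tau_nbhd_far k n z : val z = (omega_pow k.+1, omega_pow k.+1) ->
  tau_nbhd alpha k.+1 n `<=` [set x | x = z \/ far k n x].
Proof.
move=> vz x; rewrite /tau_nbhd /far /=; case ex: (val x) => [a b] /=.
rewrite !lt_omega_powP => -[[ha hb hn]|e]; last first.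
  by left; apply: val_inj; rewrite ex vz.
by right; split=> //; apply/orP; case: hn => hn; [left|right];
  exact: coef_ge_omega_pow_mul.
Qed.

Lemma tau_nbhd_sup k n z : val z = (omega_pow k.+1, omega_pow k.+1) ->
  [set x | x = z \/ far k n.+1 x] `<=` tau_nbhd alpha k.+1 n.
Proof.
move=> vz x [->|/far_tau_nbhd//]; rewrite /tau_nbhd/= vz; by right.
Qed.

Lemma far_axis k n z : val z = (omega_pow k.+1, omega_pow k.+1) ->
  let x := pt alpha 0%:O (pow_iter k n 0%:O) in far k n x /\ x <> z.
Proof.
move=> vz x; have s0 : (ord_size 0%:O <= k.+1)%N by rewrite ord_size0.
have [s1 c1] := coef_pow_iter n s0.
have vx : val x = (0%:O, pow_iter k n 0%:O).
  by rewrite val_pt//; [exact: lt_omega_pow0|exact: (lt_corner vz)].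
split; first by rewrite /far/= vx; split=> //=; rewrite c1; lia.
move=> xz; move: vx; rewrite xz vz => -[/(congr1 ord_size) + _].
by rewrite ord_size_omega_pow ord_size0.
Qed.

Lemma corner_nbhs tau k z : lc_shift_topologies B tau ->
  val z = (omega_pow k.+1, omega_pow k.+1) -> ~ opens tau [set z] ->
  nbhs (z : topologized tau) =
    filter_from [set n | (0 < n)%N] (tau_nbhd alpha k.+1).
Proof.
move=> [tauH tauL tauC] vz nz.
have [K [_ _ base]] := corner_base alpha_ge1 tauH tauC vz tauL nz.
apply/seteqP; split=> [W zW|W [n _ nW]].
  (* The successor only makes the index positive. *)
  have [n nW] := base W zW; exists n.+1 => // x /(tau_nbhd_far vz)[->|fx].
    exact: nbhs_singleton zW.
  by apply: nW; apply: far_le fx.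
apply: filterS (far_nbhs alpha_ge1 tauH tauC vz n.+1) => x fx.
by apply: nW; exact: (tau_nbhd_sup vz).
Qed.

Lemma sigma_isolated i j z : (i <= j%:O)%O ->
  val z = (omega_pow j, omega_pow j) -> opens (sigma alpha i) [set z].
Proof.
move=> ij vz; suff -> : [set z] = up i z by exact: sigma_open_up.
apply/seteqP; split=> [_ ->|x [t ht]] /=; first exact: up_refl.
rewrite vz => -[e1 e2]; have t0 : t = 0%:O.
  case: (ord_add_eq_pow (esym e1)) => -[_ //] t1.
  by move: ht; rewrite t1 lt_omega_pow_pow ltNge ij.
rewrite t0 !ord_addr0 in e1 e2.
by apply: val_inj; rewrite vz [val x]surjective_pairing -e1 -e2.
Qed.

(** A basic neighbourhood of [z] removes finitely many up-sets, and [(0, n omega^k)] escapes them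
    all once n exceeds the coefficients of index k of the second coordinates of their base
    points. *)
Lemma sigma_nonisolated i k z : (k.+1%:O < i)%O ->
  val z = (omega_pow k.+1, omega_pow k.+1) -> ~ opens (sigma alpha i) [set z].
Proof.
move=> ki vz oz; have [S Sz SU] := oz z erefl.
have [n hn] : exists n, forall w, w \in S -> (coef (val w).2 k < n)%N.
  elim: S {Sz SU} => [|w S [n hn]]; first by exists 0.
  exists (maxn n (coef (val w).2 k).+1) => v.
  by rewrite inE => /predU1P[->|/hn]; lia.
have [[f1 f2 _] xz] := far_axis n vz; apply: xz; move: f1 f2.
set x := pt _ _ _ => f1 f2.
have vx : val x = (0%:O, pow_iter k n 0%:O).
  rewrite val_pt//; first exact: lt_omega_pow0.
  apply: (lt_corner vz).
  by case: (@coef_pow_iter k n 0%:O); rewrite ?ord_size0.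
apply: SU => [|w wS [t ht ew]].
  exists (omega_pow k.+1); first by rewrite lt_omega_pow_pow.
  by rewrite vz !ord_add_absorb.
have s0 : (ord_size 0%:O <= k.+1)%N by rewrite ord_size0.
have [s1 c1] := coef_pow_iter n s0.
(* A difference of at least omega^(k+1) absorbs both coordinates of [x], which would put [z] itself
   into the removed up-set. *)
case: (leP (omega_pow k.+1) t) => [/ord_sub_exists[u eu]|].
  apply: (Sz w wS); exists u.
    by move: ht; rewrite eu; exact: lt_omega_pow_addr.
  by rewrite ew vz eu !ord_addA !ord_add_absorb.
rewrite lt_omega_powP => st.
have := hn w wS; rewrite ew vx /= coef_add c1.
case: ifP => [|_]; first lia.
by case: ifP; lia.
Qed.

Lemma is_tau_sigma i : is_tau alpha i (sigma alpha i).
Proof.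
split; first exact: sigma_lc.
  by move=> j x ij _ vx; exact: (sigma_isolated ij vx).
move=> [//|k] x _ ki vx; apply: corner_nbhs => //; first exact: sigma_lc.
exact: sigma_nonisolated vx.
Qed.

(** At each z_j either the finer topology is discrete or both filters are prescribed and equal. The
    case [i' = i] gives uniqueness. *)
Lemma is_tau_coarser i i' tau rho : (i <= i')%O ->
  is_tau alpha i tau -> is_tau alpha i' rho -> coarser rho tau.
Proof.
move=> ii' [[tauH _ tauC] tau2 tau3] [[rhoH _ rhoC] _ rho3].
apply: coarser_corner => // j z j0 vz; case: (leP i j%:O) => ij.
  have ja : (j%:O < alpha)%O.
    by have [] := bicyclic_lt z; rewrite vz lt_omega_pow_pow.
  move=> W zW; apply: filterS (opens_nbhs (tau2 j z ij ja vz) erefl) => _ ->.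
  exact: nbhs_singleton zW.
by rewrite (tau3 j z j0 ij vz) (rho3 j z j0 (lt_le_trans ij ii') vz).
Qed.

(** If i < i', then i is a positive integer, and z_i, which belongs to the monoid, is isolated in
    [tau] but not in [rho]. *)
Lemma is_tau_le i i' tau rho : (alpha <= omega)%O ->
  ord_segment alpha i -> ord_segment alpha i' ->
  is_tau alpha i tau -> is_tau alpha i' rho -> coarser tau rho -> (i' <= i)%O.
Proof.
move=> aw /andP[i1 ia] /andP[i'1 i'a] [_ tau2 _] [_ _ rho3] tr.
rewrite leNgt; apply/negP => ii'.
have /ord_lt_omega[j ej] : (i < omega)%O.
  by apply: lt_le_trans ii' _; exact: le_trans i'a aw.
case: j ej => [|k] ej; first by move: i1; rewrite ej ord_nat_le.
have ka : (k.+1%:O < alpha)%O by rewrite -ej; exact: lt_le_trans ii' i'a.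
pose z := pt alpha (omega_pow k.+1) (omega_pow k.+1).
have vz : val z = (omega_pow k.+1, omega_pow k.+1).
  by rewrite val_pt// lt_omega_pow_pow.
have oz : opens rho [set z].
  by apply: tr; apply: (tau2 k.+1 z) => //; rewrite ej.
have : nbhs (z : topologized rho) [set z] by exact: opens_nbhs oz erefl.
rewrite (rho3 k.+1 z)// -?ej// => -[n _ hn].
have [fx xz] := far_axis n.+1 vz.
by apply: xz; apply: hn; exact: far_tau_nbhd.
Qed.

(** The index is the least positive j with z_j isolated, or [alpha] if there is none; [corner_lower]
    makes the later points isolated as well. *)
Lemma is_tau_exists tau : lc_shift_topologies B tau ->
  exists2 i, ord_segment alpha i & is_tau alpha i tau.
Proof.
move=> tauP; have [tauH tauL tauC] := tauP.
pose P j := `[< (0 < j)%N /\ exists z : B,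
  val z = (omega_pow j, omega_pow j) /\ opens tau [set z] >].
have noniso k z : ~ P k.+1 -> val z = (omega_pow k.+1, omega_pow k.+1) ->
    ~ opens tau [set z].
  by move=> nP vz oz; apply: nP; apply/asboolP; split=> //; exists z.
case: (pselect (exists j, P j)) => [exP|nP].
  case: (ex_minnP exP) => j /asboolP[j0 [z [vz oz]]] minj.
  have ja : (j%:O < alpha)%O.
    by have [] := bicyclic_lt z; rewrite vz lt_omega_pow_pow.
  exists j%:O; first by rewrite /ord_segment/= ord_nat_le j0 ltW.
  split=> //.
    move=> j' x; rewrite ord_nat_le leq_eqVlt => /predU1P[jj' _ vx|jj' _ vx].
      suff -> : x = z by [].
      by apply: val_inj; rewrite vx vz jj'.
    apply: contrapT => nx.
    case: j jj' j0 vz {minj ja} => // m; case: j' vx => // k vx mk _ vz.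
    by apply: (corner_lower alpha_ge1 tauH tauC tauL vx vz mk nx).
  move=> [//|k] x _; rewrite ord_nat_lt => kj vx.
  by apply: corner_nbhs => //; apply: noniso vx => /minj; lia.
exists alpha; first by rewrite /ord_segment/= alpha_ge1 lexx.
split=> // [j x aj|[//|k] x _ _ vx]; first by rewrite ltNge aj.
by apply: corner_nbhs => //; apply: noniso vx => Pk; apply: nP; exists k.+1.
Qed.

Lemma is_tau_eq i : is_tau alpha i = [set tau alpha i].
Proof.
have ex : is_tau alpha i (tau alpha i).
  by apply: (xgetPex _ (ex_intro _ _ (is_tau_sigma i))).
apply/seteqP; split=> [rho hrho|_ ->//].
by apply: topology_inj; apply/seteqP; split; exact: is_tau_coarser (lexx i) _ _.
Qed.

End Classification.

Theorem corollary16 (alpha : ord) (alpha_ge1 : (1%:O <= alpha)%O)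
    (alpha_le_omega : (alpha <= omega)%O) :
  [/\ forall i : ord, ord_segment alpha i ->
        is_tau alpha i = [set tau alpha i],
      lc_shift_topologies (bicyclic alpha) = tau alpha @` ord_segment alpha,
      forall sigma rho : topology (bicyclic alpha),
        lc_shift_topologies (bicyclic alpha) sigma ->
        lc_shift_topologies (bicyclic alpha) rho ->
        coarser sigma rho \/ coarser rho sigma
    & anti_isomorphic
        (lc_shift_topologies (bicyclic alpha)) (@coarser (bicyclic alpha))
        (ord_segment alpha) (fun i j : ord => (i <= j)%O)].
Proof.
have tauP i : is_tau alpha i (tau alpha i) by rewrite is_tau_eq.
have lcE :
    lc_shift_topologies (bicyclic alpha) = tau alpha @` ord_segment alpha.
  apply/seteqP; split=> [rho /(is_tau_exists alpha_ge1)[i hi]|_ [i _ <-]].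
    by rewrite is_tau_eq// => ->; exists i.
  by case: (tauP i).
have coarserE i j : ord_segment alpha i -> ord_segment alpha j ->
    coarser (tau alpha i) (tau alpha j) <-> (j <= i)%O.
  move=> hi hj; split=> [|ji]; last exact: is_tau_coarser ji (tauP j) (tauP i).
  exact: is_tau_le alpha_le_omega hi hj (tauP i) (tauP j).
split=> // [i _||].
- exact: is_tau_eq.
- rewrite lcE => _ _ [i hi <-] [j hj <-]; rewrite !coarserE//.
  by apply/orP; exact: le_total.
(* The inverse of [tau alpha] on the segment; the default value 1 is taken only outside of the
   lattice. *)
- pose f rho : ord :=
    xget 1%:O [set i | ord_segment alpha i /\ tau alpha i = rho].
  have fP i : ord_segment alpha i -> f (tau alpha i) = i.
    move=> hi; rewrite /f; case: xgetP => [j _ [hj e]|/(_ i)]; last by case.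
    by apply/eqP; rewrite eq_le; apply/andP; split;
      apply/(coarserE _ _ _ _).1 => //; rewrite e.
  exists f; last first.
    by rewrite lcE => _ _ [i hi <-] [j hj <-]; rewrite !fP// coarserE.
  rewrite lcE; split.
  + by move=> _ [i hi <-]; rewrite fP.
  + by move=> _ _ /set_mem[i hi <-] /set_mem[j hj <-]; rewrite !fP// => ->.
  + by move=> i hi; exists (tau alpha i); [exists i|rewrite fP].
Qed.
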